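(* Let $n\ge 3$. For the cyclic Nakayama algebra $\Lambda^{n-1}_n$, the size of a full weak exceptional collection is $s(\Lambda^{n-1}_n)=2n-2$, and the number of distinct full weak exceptional sequences is $\#(\Lambda^{n-1}_n)=n$.
   Context: Let $K$ be a field. For integers $n\ge 2$ and $k\ge 2$, $\Lambda^k_n$ denotes the selfinjective Nakayama $K$-algebra given by the cyclic quiver with vertices $1,\dots,n$ and arrows $\eta_i:i\to i+1$ for $1\le i\le n-1$ and $\eta_n:n\to 1$, modulo all paths of length $k$, so that every indecomposable projective module has length $k$. The projective $P_i$ is uniserial with composition factors from the top $S_i,S_{i+1},S_{i+2},\dots$ (indices mod $n$). For a finite dimensional algebra $A$: a (finite dimensional) module $M$ is weak exceptional if $\mathrm{Hom}_A(M,M)\cong K$ and $\mathrm{Ext}^1_A(M,M)=0$. A pair $(M,N)$ is a weak exceptional pair if $M,N$ are weak exceptional, $\mathrm{Hom}_A(N,M)=0$ and $\mathrm{Ext}^1_A(N,M)=0$. (Higher extensions are allowed to be nonzero.) A tuple $(M_1,\dots,M_r)$ is a weak exceptional sequence (or collection) if $(M_i,M_j)$ is a weak exceptional pair for all $1\le i<j\le r$. Sequences are ordered sequences of isomorphism classes of modules. The size of such a sequence is the number of distinct modules in it. Write $s(A)$ for the supremum of the sizes of weak exceptional sequences of $A$; a weak exceptional sequence is full if its size equals $s(A)$; $\#(A)$ is the number of distinct full weak exceptional sequences of $A$. *)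

(* Defs.v *)
From HB Require Import structures.
From mathcomp Require Import all_boot all_order all_algebra all_field.
From mathcomp Require Import boolp classical_sets functions cardinality.
From mathcomp Require Import constructive_ereal ereal.

Set Implicit Arguments.
Unset Strict Implicit.
Unset Printing Implicit Defensive.
Import Order.TTheory GRing.Theory Num.Theory.
Local Open Scope classical_set_scope.
Local Open Scope ring_scope.

(* Finite dimensional left modules, homomorphisms and first extensions over   *)
(* a finite dimensional K-algebra                                             *)

(* The underlying vector space is some K^d, so that the type of modules stays *)
(* small; every finite dimensional module is isomorphic to one of this form.  *)
Record fdmod (K : fieldType) (A : falgType K) := FdMod {
  fdmod_dim : nat;
  fdmod_act : {linear A -> 'End('cV[K]_fdmod_dim)};
  fdmod_act1 : fdmod_act 1 = \1%VF;
  fdmod_actM : forall a b : A,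
    fdmod_act (a * b) = (fdmod_act a \o fdmod_act b)%VF
}.

Definition fdmod_sort (K : fieldType) (A : falgType K) (M : fdmod A) :
  vectType K := 'cV[K]_(fdmod_dim M).
Coercion fdmod_sort : fdmod >-> Vector.type.

Section Modules.
Variables (K : fieldType) (A : falgType K).
Implicit Types M N : fdmod A.

Definition is_hom M N (f : 'Hom(M, N)) : Prop :=
  forall (a : A) (x : M), f (fdmod_act M a x) = fdmod_act N a (f x).

Definition hom_defect M N (a : A) (f : 'Hom(M, N)) : 'Hom(M, N) :=
  (f \o fdmod_act M a)%VF - (fdmod_act N a \o f)%VF.

Fact hom_defect_is_linear M N a : linear (@hom_defect M N a).
Proof.
move=> c f g; rewrite /hom_defect comp_lfunDl comp_lfunDr.
by rewrite -comp_lfunZl -comp_lfunZr opprD addrACA scalerBr.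
Qed.

HB.instance Definition _ M N a :=
  GRing.isLinear.Build K 'Hom(M, N) 'Hom(M, N) _ (@hom_defect M N a)
    (@hom_defect_is_linear M N a).

(* Hom_A(M, N) as a K-subspace of Hom_K(M, N); see [memv_homA].  It is enough *)
(* to require A-linearity for the elements of a K-basis of A.                 *)
Definition homA M N : {vspace 'Hom(M, N)} :=
  (\bigcap_(i < \dim {:A}) lker (linfun (@hom_defect M N (vbasis {:A})`_i)))%VS.

Lemma memv_homA M N (f : 'Hom(M, N)) : f \in homA M N <-> is_hom f.
Proof.
have hE a : hom_defect a f = 0 <->
    forall x, f (fdmod_act M a x) = fdmod_act N a (f x).
  split=> [h x|h].
    by apply/eqP; rewrite -subr_eq0 -!comp_lfunE -opp_lfunE -add_lfunE
      -/(hom_defect a f) h zero_lfunE.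
  by apply/lfunP => x; rewrite add_lfunE opp_lfunE !comp_lfunE h subrr zero_lfunE.
rewrite /homA; split=> [/subv_bigcapP h a|h].
  move=> x; rewrite (coord_vbasis (memvf a)) !linear_sum !sum_lfunE linear_sum.
  apply: eq_bigr => i _; rewrite !linearZ !scale_lfunE linearZ /=.
  congr (_ *: _); apply/hE: x; have := h i isT.
  by rewrite -memvE memv_ker lfunE /= => /eqP.
apply/subv_bigcapP => i _; rewrite -memvE memv_ker lfunE /=; apply/eqP.
by apply/hE => x; exact: h.
Qed.

Definition iso M N : Prop :=
  exists2 f : 'Hom(M, N), is_hom f & lker f = 0%VS /\ limg f = fullv.

(* Short exact sequences 0 -> N -> E -> M -> 0.                               *)
Record extension M N := Extension {
  ext_mid : fdmod A;
  ext_inj : 'Hom(N, ext_mid);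
  ext_proj : 'Hom(ext_mid, M);
  ext_inj_hom : is_hom ext_inj;
  ext_proj_hom : is_hom ext_proj;
  ext_inj_mono : lker ext_inj = 0%VS;
  ext_exact : limg ext_inj = lker ext_proj;
  ext_proj_epi : limg ext_proj = fullv
}.

Definition ext_equiv M N (X Y : extension M N) : Prop :=
  exists2 h : 'Hom(ext_mid X, ext_mid Y), is_hom h &
    (h \o ext_inj X = ext_inj Y)%VF /\ (ext_proj Y \o h = ext_proj X)%VF.

(* Ext^1_A(M, N) is taken in Yoneda's sense, as the group of equivalence      *)
(* classes of extensions; it vanishes when there is only one class.           *)
Definition ext1_eq0 M N : Prop := forall X Y : extension M N, ext_equiv X Y.

Definition weak_exceptional M : Prop := \dim (homA M M) = 1%N /\ ext1_eq0 M M.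

Definition weak_exceptional_pair M N : Prop :=
  [/\ weak_exceptional M, weak_exceptional N,
      homA N M = 0%VS & ext1_eq0 N M].

(* The first conjunct only matters for sequences of length 1.                 *)
Definition weak_exceptional_seq (s : seq (fdmod A)) : Prop :=
  all (fun M => `[< weak_exceptional M >]) s /\
  pairwise (fun M N => `[< weak_exceptional_pair M N >]) s.

Definition iso_class M : set (fdmod A) := [set N | iso M N].

(* Weak exceptional sequences (wes), as sequences of isomorphism classes.     *)
Definition wes : set (seq (set (fdmod A))) :=
  [set map iso_class s | s in [set s | weak_exceptional_seq s]].

Definition wes_size (c : seq (set (fdmod A))) : nat := size (undup c).

(* A set of integers has the same supremum in the extended rationals as in    *)
(* the extended reals; it is +oo when the sizes are unbounded.                *)
Definition wes_sup : \bar rat :=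
  ereal_sup [set (wes_size c)%:R%:E | c in wes].

Definition full_wes : set (seq (set (fdmod A))) :=
  [set c | wes c /\ (wes_size c)%:R%:E = wes_sup].

End Modules.

Arguments wes {K} A.
Arguments wes_sup {K} A.
Arguments full_wes {K} A.

(* The algebra Lambda^k_n: the path algebra of the cyclic quiver with n       *)
(* vertices modulo the paths of length k.  The residue classes of the paths   *)
(* of length < k form a basis, and a path is determined by its source i and   *)
(* its length l, so that an element is a family of coefficients indexed by    *)
(* the pairs (i, l).  Vertices are taken in Z/n, with an arrow i -> i + 1     *)
(* for each i.  The encoding is only meant for n >= 2 and k >= 1.             *)

Definition nakayama (K : fieldType) (n k : nat) : Type :=
  {ffun 'Z_n * 'I_k.-1.+1 -> K^o}.

Section Nakayama.
Variables (K : fieldType) (n k : nat).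
Local Notation L := (nakayama K n k).
Implicit Types a b c : L.

HB.instance Definition _ := Vector.on L.

(* The residue class of the path of length l starting at i.                   *)
Definition npath (i : 'Z_n) (l : nat) : L :=
  [ffun p : 'Z_n * 'I_k.-1.+1 => ((p.1 == i) && (p.2 == l :> nat))%:R].

(* As for maps, a * b is b followed by a, so that left modules are covariant  *)
(* representations of the quiver.  A path of length l from i is, for each     *)
(* j <= l, its initial part of length j followed by a path of length l - j    *)
(* from i + j; see [npathM].                                                  *)
Definition nakayama_mul a b : L :=
  [ffun p : 'Z_n * 'I_k.-1.+1 => \sum_(j < p.2.+1)
     (a (p.1 + j%:R, inord (p.2 - j)) : K) * b (p.1, inord j)].

Definition nakayama_one : L :=
  [ffun p : 'Z_n * 'I_k.-1.+1 => (p.2 == 0 :> nat)%:R].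

Let inord_subK (l : 'I_k.-1.+1) j :
  (inord (l - j) : 'I_k.-1.+1) = (l - j)%N :> nat.
Proof. by rewrite inordK // (leq_ltn_trans (leq_subr _ _)). Qed.

Let inord_leK (l : 'I_k.-1.+1) (j : 'I_l.+1) :
  (inord j : 'I_k.-1.+1) = j :> nat.
Proof. by rewrite inordK // (leq_ltn_trans _ (ltn_ord l)) // leq_ord. Qed.

Fact nakayama_mulA : associative nakayama_mul.
Proof.
move=> a b c; apply/ffunP => -[i l]; rewrite !ffunE /=.
pose co (x : L) i l : K := x (i, inord l).
have mulE x y i' (l' : 'I_k.-1.+1) : nakayama_mul x y (i', l') =
    \sum_(j < l'.+1) co x (i' + j%:R) (l' - j)%N * co y i' j.
  by rewrite ffunE.
under eq_bigr => j _ do rewrite mulE inord_leK big_distrr /=.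
under [RHS]eq_bigr => j _ do rewrite mulE inord_subK big_distrl /=.
have hl (j : 'I_l.+1) : (j <= l)%N by exact: leq_ord.
pose t j m := co a (i + (j + m)%:R) (l - (j + m))%N *
  (co b (i + j%:R) m * co c i j).
transitivity (\sum_(j < l.+1) \sum_(m < l.+1 | (m <= j)%N) t m (j - m)%N).
  apply: eq_bigr => j _.
  rewrite (big_ord_narrow_leq (hl j)) /=.
  apply: eq_bigr => m _; rewrite /t subnKC ?leq_ord //.
rewrite (exchange_big_dep predT) //=; apply: eq_bigr => m _.
transitivity (\sum_(m <= j < l.+1) t m (j - m)%N).
  by rewrite big_geq_mkord; apply: eq_bigl => j.
rewrite -{1}[val m]add0n big_addn subSn ?leq_ord // big_mkord; apply: eq_bigr => j _.
by rewrite addnK /t /co natrD addrA subnDA mulrA.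
Qed.

Fact nakayama_mul1 : left_id nakayama_one nakayama_mul.
Proof.
move=> a; apply/ffunP => -[i l]; rewrite !ffunE /= (bigD1 ord_max) //= big1.
  rewrite ffunE /= inord_subK subnn eqxx mul1r addr0.
  by congr (a (i, _)); apply: val_inj; rewrite /= inordK.
move=> j nj; rewrite ffunE /= inord_subK subn_eq0 leqNgt.
by rewrite ltn_neqAle nj leq_ord mul0r.
Qed.

Fact nakayama_mulr1 : right_id nakayama_one nakayama_mul.
Proof.
move=> a; apply/ffunP => -[i l]; rewrite !ffunE /= big_ord_recl /= big1.
  rewrite ffunE /= inordK // eqxx mulr1 !addr0 subn0.
  by congr (a (i, _)); apply: val_inj; rewrite /= inordK.
by move=> j _; rewrite ffunE (inord_leK (lift ord0 j)) mulr0.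
Qed.

Fact nakayama_mulDl : left_distributive nakayama_mul +%R.
Proof.
move=> a b c; apply/ffunP => p; rewrite !ffunE -big_split /=.
by apply: eq_bigr => j _; rewrite ffunE mulrDl.
Qed.

Fact nakayama_mulDr : right_distributive nakayama_mul +%R.
Proof.
move=> a b c; apply/ffunP => p; rewrite !ffunE -big_split /=.
by apply: eq_bigr => j _; rewrite ffunE mulrDr.
Qed.

Fact nakayama_one_neq0 : nakayama_one != 0.
Proof.
apply/eqP => /ffunP /(_ (0, ord0)); rewrite !ffunE /=.
by move/eqP; rewrite oner_eq0.
Qed.

HB.instance Definition _ := GRing.Zmodule_isNzRing.Build L
  nakayama_mulA nakayama_mul1 nakayama_mulr1 nakayama_mulDl nakayama_mulDr
  nakayama_one_neq0.

Fact nakayama_scalerAl (x : K) a b : x *: (a * b) = (x *: a) * b.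
Proof.
apply/ffunP => p; rewrite !ffunE scaler_sumr.
by apply: eq_bigr => j _; rewrite ffunE -mulrA.
Qed.

HB.instance Definition _ := GRing.Lmodule_isLalgebra.Build K L nakayama_scalerAl.

Fact nakayama_scalerAr (x : K) a b : x *: (a * b) = a * (x *: b).
Proof.
apply/ffunP => p; rewrite !ffunE scaler_sumr.
by apply: eq_bigr => j _; rewrite ffunE mulrCA.
Qed.

HB.instance Definition _ :=
  GRing.Lalgebra_isAlgebra.Build K L nakayama_scalerAr.

HB.instance Definition _ := Algebra_isFalgebra.Build K L.

Lemma npathM (i j : 'Z_n) (l m : nat) :
  npath j m * npath i l =
  if (j == i + l%:R) && (l + m < k.-1.+1)%N then npath i (l + m) else 0.
Proof.
apply/ffunP => -[v r]; rewrite !ffunE /=.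
have -> : (if (j == i + l%:R) && (l + m < k.-1.+1)%N then npath i (l + m) else 0)
    (v, r) = [&& j == i + l%:R, v == i & r == (l + m)%N :> nat]%:R :> K.
  case: ifP => [/andP[-> _]|jlm]; rewrite !ffunE //=.
  case: eqP jlm => //= _ /negbT; rewrite -leqNgt => klm.
  by rewrite (ltn_eqF (leq_trans (ltn_ord r) klm)) andbF.
under eq_bigr => t _ do rewrite !ffunE /= inord_subK inord_leK -natrM mulnb.
case: (eqVneq v i) => [->|_]; last first.
  by rewrite big1 ?andbF // => t _; rewrite andbF.
have [lr|rl] := ltnP l r.+1; last first.
  have -> : (r == (l + m)%N :> nat) = false.
    by apply: ltn_eqF; apply: leq_trans rl (leq_addr _ _).
  rewrite !andbF big1 // => t _.
  by rewrite (ltn_eqF (leq_trans (ltn_ord t) rl)) !andbF.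
rewrite (bigD1 (Ordinal lr)) //= big1 ?addr0 => [|t]; last first.
  by rewrite -val_eqE /= => /negbTE ->; rewrite !andbF.
by rewrite eqxx andbT eq_sym -(eqn_add2l l) subnKC.
Qed.

End Nakayama.

Arguments nakayama K n k : clear implicits.

(* Main.v *)
Require Import Defs.
From HB Require Import structures.
From mathcomp Require Import all_boot all_order all_algebra all_field.
From mathcomp Require Import boolp classical_sets functions cardinality.
From mathcomp Require Import constructive_ereal ereal.
From mathcomp Require Import zify.

(** A brick over the Nakayama algebra is uniserial ([brick_uniserial]): the
submodule generated by a vector that survives under the highest possible power
of the arrows is injective over the quotient of the algebra by the paths that act as zero,
hence a direct summand.  So the weak exceptional modules are the
uniserial modules of length at most n - 1, and each of them is given by an arc
(p, q), an ordered pair of distinct points of a circle with n points: its top is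
at p and its composition factors fill the circle from p to q - 1.  A homomorphism
or an extension between two uniserial modules is determined by the image of a
generator, which yields numerical criteria ([uniserial_homA0],
[uniserial_ext0], [uniserial_ext_neq0]).  They translate into geometry: in a weak
exceptional sequence no two chords cross and no two arcs have complements that
are apart from each other; of two arcs with the same start the longer one comes
first, of two arcs with the same end the shorter one comes first, and an arc that
ends at p comes before any arc that starts at p, except the opposite arc.

Look at the sequence as a plane graph whose edges are chords taken with one or
both orientations.  No side of a polygon can have both ([polygon_single]).
Indeed, along consecutive sides the precedences all run in the same direction
unless both sides are backward, and backward sides of a polygon have to touch;
with a doubled side the precedences would run around the whole polygon.  So a
doubled edge is a bridge, and an induction on intervals of points
([count_boundP]) shows that there are at most 2 (n - 1) arcs, with equality only
if every edge is doubled.  Doubled edges pairwise share an endpoint, since two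
disjoint ones would contain arcs with complements apart, and they do not form a
triangle.  In the case of equality all the chords therefore pass through one
point v ([star_center]), and the order of the arcs is forced: first those that
end at v, by increasing length, then those that start at v, by decreasing length
([full_star]).  Conversely, each of the n stars is a weak exceptional sequence
([star_before]). *)

Set Implicit Arguments.
Unset Strict Implicit.
Unset Printing Implicit Defensive.

Local Open Scope nat_scope.

(** * Arcs on a circle *)

(** Settles a goal on [steps] when the context orders all the points involved. *)
Ltac solve_off :=
  repeat match goal with |- context [if ?x <= ?y then _ else _] =>
    first [rewrite (_ : (x <= y) = true); last lia |
           rewrite (_ : (x <= y) = false); last lia] end; lia.

Section Arcs.
Variable n : nat.

(** The number of steps from x to y around the circle of n points. *)
Definition steps (x y : nat) := if x <= y then y - x else y + n - x.

Lemma stepsP x y : (x <= y /\ steps x y = y - x) \/ (y < x /\ steps x y = y + n - x).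
Proof. by rewrite /steps; case: leqP => h; [left | right]. Qed.

(** The pair (p, q) stands for the uniserial module with top at p and length
steps p q, whose composition factors sit at the points p, ..., q - 1.  Lengths
run from 1 to n - 1, hence p and q differ. *)
Definition is_arc (e : nat * nat) := [&& e.1 < n, e.2 < n & e.1 != e.2].

(** A nonzero map from b to a has as image the end of a that starts where b
starts; it exists when this end is a beginning of b. *)
Definition arc_hom (b a : nat * nat) :=
  steps a.1 b.1 < steps a.1 a.2 <= steps a.1 b.1 + steps b.1 b.2.

(** A nonsplit extension of b by a has uniserial summands going from the start of
b to the end of a and from the start of a to the end of b, the second one
possibly zero.  The last condition says that the first one is not longer
than a projective module. *)
Definition arc_ext (b a : nat * nat) :=
  [&& steps a.1 b.2 < steps a.1 a.2, steps a.1 b.2 < steps b.1 b.2 &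
      steps a.1 a.2 + steps b.1 b.2 <= steps a.1 b.2 + n.-1].

(** The order in which a and b may occur in a weak exceptional sequence. *)
Definition before (a b : nat * nat) := ~~ arc_hom b a && ~~ arc_ext b a.

Lemma before_irr a : is_arc a -> ~~ before a a.
Proof.
case: a => p q; rewrite /is_arc /before /arc_hom /arc_ext /=.
by have := stepsP p p; have := stepsP p q; lia.
Qed.

Lemma before_start p q q' : is_arc (p, q) -> is_arc (p, q') ->
  before (p, q) (p, q') = (steps p q' < steps p q).
Proof.
rewrite /is_arc /before /arc_hom /arc_ext /=.
have := stepsP p p; have := stepsP p q; have := stepsP p q'.
by lia.
Qed.

Lemma before_end p p' q : is_arc (p, q) -> is_arc (p', q) ->
  before (p, q) (p', q) = (steps p q < steps p' q).
Proof.
rewrite /is_arc /before /arc_hom /arc_ext /=.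
have := stepsP p p'; have := stepsP p q; have := stepsP p' q.
by lia.
Qed.

Lemma before_head p q r : is_arc (p, q) -> is_arc (q, r) -> before (p, q) (q, r).
Proof.
rewrite /is_arc /before /arc_hom /arc_ext /=.
have := stepsP p q; have := stepsP q r; have := stepsP p r.
by lia.
Qed.

Lemma before_tail p q r : is_arc (p, q) -> is_arc (q, r) -> p != r ->
  ~~ before (q, r) (p, q).
Proof.
rewrite /is_arc /before /arc_hom /arc_ext /=.
have := stepsP q p; have := stepsP q r; have := stepsP p q; have := stepsP q q.
by lia.
Qed.

(** Crossing chords are excluded in all orientations: either there are an extension
and a homomorphism in opposite directions, or the arcs cover the circle and
overlap at both ends. *)
Lemma before_cross a x c y : a < x -> x < c -> c < y -> y < n ->
  forall e f, (e = (a, c)) \/ (e = (c, a)) -> f = (x, y) \/ f = (y, x) ->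
  ~~ before e f && ~~ before f e.
Proof.
move=> ax xc cy yn e f [->|->] [->|->]; rewrite /before /arc_hom /arc_ext /=;
by rewrite /steps; solve_off.
Qed.

(** The complements [x, q) and [u, v) of the two arcs are disjoint and not even
adjacent, so that the arcs overlap at both ends and there are nonzero
homomorphisms in both directions. *)
Lemma before_far q u v x : q < n -> x < n -> u < n -> v < n ->
  0 < steps q u -> steps q u < steps q v -> steps q v < steps q x ->
  ~~ before (q, x) (v, u) && ~~ before (v, u) (q, x).
Proof.
rewrite /before /arc_hom /arc_ext /= /steps.
case: (leqP q u) => qu; case: (leqP q v) => qv; case: (leqP q x) => qx; try lia;
by move=> *; solve_off.
Qed.

Lemma steps_xx x : steps x x = 0.
Proof. by rewrite /steps leqnn subnn. Qed.

Lemma steps_cycle q x y z : q < n -> x < n -> y < n -> z < n ->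
  steps q x < steps q y < steps q z -> 0 < steps x y < steps x z.
Proof.
move=> qn xn yn zn; rewrite /steps.
by case: (leqP q x) => qx; case: (leqP q y) => qy; case: (leqP q z) => qz h;
  try lia; solve_off.
Qed.

Lemma steps_end x y z : x < n -> y < n -> z < n ->
  0 < steps x y < steps x z -> steps x y < steps z y.
Proof.
have := stepsP x y; have := stepsP x z; have := stepsP z y; lia.
Qed.

Lemma steps_rotate x y z : x < n -> y < n -> z < n ->
  0 < steps x y < steps x z -> 0 < steps y z < steps y x.
Proof.
have := stepsP x y; have := stepsP x z; have := stepsP y z; have := stepsP y x; lia.
Qed.
End Arcs.

(** * Precedence in a collection of arcs *)

Section Collections.
Variables (n : nat) (s : seq (nat * nat)).
Hypotheses (s_arc : forall e, e \in s -> is_arc n e) (s_before : pairwise (before n) s).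
Local Notation before := (before n).

Lemma s_uniq : uniq s.
Proof.
rewrite uniq_pairwise; apply: (sub_in_pairwise (P := mem s)) (allss _) s_before.
move=> a b /s_arc /before_irr na _ ab /=.
by apply: contraNneq na => e; rewrite {2}e.
Qed.

Definition prec (a b : nat * nat) := index a s < index b s.

Lemma prec_trans : transitive prec.
Proof. by move=> b a c; exact: ltn_trans. Qed.

Lemma prec_irr : irreflexive prec.
Proof. by move=> a; rewrite /prec ltnn. Qed.

Lemma prec_before a b : a \in s -> b \in s -> prec a b -> before a b.
Proof.
move=> ia ib ab.
have := pairwiseP a s_before (index a s) (index b s).
by rewrite !nth_index // !inE !index_mem => /(_ ia ib ab).
Qed.

(** As any two terms are comparable, each configuration excluded in one order
imposes the other order. *)
Lemma not_before_prec a b : a \in s -> b \in s -> a != b -> ~~ before b a -> prec a b.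
Proof.
move=> ia ib nab nba; rewrite /prec ltn_neqAle; apply/andP; split.
  by apply: contraNneq nab => /(congr1 (nth a s)); rewrite !nth_index // => ->.
by rewrite leqNgt; apply: contra nba; exact: prec_before.
Qed.

Lemma s_comparable a b : a \in s -> b \in s -> a != b -> before a b || before b a.
Proof.
move=> ia ib ab; apply: contraT; rewrite negb_or => /andP[nab nba].
have h1 := not_before_prec ia ib ab nba.
rewrite eq_sym in ab; have := prec_trans h1 (not_before_prec ib ia ab nab).
by rewrite prec_irr.
Qed.

Lemma prec_start p q q' : (p, q) \in s -> (p, q') \in s -> steps n p q' < steps n p q ->
  prec (p, q) (p, q').
Proof.
move=> i1 i2 lt; apply: not_before_prec => //.
  by apply: contraTneq lt => -[->]; rewrite ltnn.
by rewrite before_start ?s_arc // -leqNgt ltnW.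
Qed.

Lemma prec_end p p' q : (p, q) \in s -> (p', q) \in s -> steps n p q < steps n p' q ->
  prec (p, q) (p', q).
Proof.
move=> i1 i2 lt; apply: not_before_prec => //.
  by apply: contraTneq lt => -[->]; rewrite ltnn.
by rewrite before_end ?s_arc // -leqNgt ltnW.
Qed.

Lemma prec_head p q r : (p, q) \in s -> (q, r) \in s -> p != r ->
  prec (p, q) (q, r).
Proof.
move=> i1 i2 pr; apply: not_before_prec; rewrite ?before_tail ?s_arc //.
by have := s_arc i1; apply: contraTneq => -[-> ->]; rewrite /is_arc eqxx !andbF.
Qed.

Definition adj a b := ((a, b) \in s) || ((b, a) \in s).

Lemma adj_sym a b : adj a b = adj b a.
Proof. by rewrite /adj orbC. Qed.

Lemma adj_arc a b : adj a b -> exists2 e, e \in s & e = (a, b) \/ e = (b, a).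
Proof. by case/orP => ie; eexists; eauto. Qed.

Lemma adj_lt a b : adj a b -> (a < n) && (b < n).
Proof. by case/orP => /s_arc /and3P[/= -> ->]. Qed.

Lemma noncrossing a x c y : a < x -> x < c -> c < y -> adj a c -> ~~ adj x y.
Proof.
move=> ax xc cy ac; apply/negP => xy; have /andP[_ yn] := adj_lt xy.
have [e ie e_ac] := adj_arc ac; have [f jf f_xy] := adj_arc xy.
have /andP[/negbTE n1 /negbTE n2] := before_cross ax xc cy yn e_ac f_xy.
have nef : e != f by apply/eqP; case: e_ac f_xy => -> [] -> []; lia.
by have := s_comparable ie jf nef; rewrite n1 n2.
Qed.

(** Take two consecutive sides {x, y} and {y, z} of a convex polygon, where x, y, z
are in cyclic order, and call an arc along a side forward when it runs in
that order.  If one of the two arcs is forward, then the arc of the first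
side precedes the one of the second side, whatever the orientation of the
other arc. *)
Lemma prec_fwd_l x y z e : steps n x y < steps n x z -> 0 < steps n x y -> (x, y) \in s ->
  e \in s -> e = (y, z) \/ e = (z, y) -> prec (x, y) e.
Proof.
move=> xyz xy i1 i2 e_yz.
have /and3P[/= xn yn _] := s_arc i1; have zn : z < n.
  by case: e_yz i2 => -> /s_arc /and3P[].
case: e_yz i2 => -> i2.
  by apply: prec_head => //; apply: contraTneq xyz => ->; rewrite steps_xx.
apply: prec_end => //.
by apply: steps_end => //; rewrite xy.
Qed.

Lemma prec_fwd_r x y z e : steps n x y < steps n x z -> 0 < steps n x y -> (y, z) \in s ->
  e \in s -> e = (x, y) \/ e = (y, x) -> prec e (y, z).
Proof.
move=> xyz xy i1 i2 e_xy.
have /and3P[/= yn zn _] := s_arc i1; have xn : x < n.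
  by case: e_xy i2 => -> /s_arc /and3P[].
case: e_xy i2 => -> i2.
  by apply: prec_head => //; apply: contraTneq xyz => ->; rewrite steps_xx.
apply: prec_start => //.
by have /andP[] : 0 < steps n y z < steps n y x by apply: steps_rotate => //; rewrite xy.
Qed.

(** A backward arc along {u, v} would be complementary to [u, v), which is apart
from the complement [x, q) of the arc (q, x). *)
Lemma middle_forward q u v x : (q, x) \in s -> adj u v ->
  0 < steps n q u -> steps n q u < steps n q v -> steps n q v < steps n q x -> (u, v) \in s.
Proof.
move=> iqx uv h1 h2 h3; have /andP[un vn] := adj_lt uv.
have /and3P[/= qn xn _] := s_arc iqx.
case/orP: uv => // ivu.
have /andP[/negbTE n1 /negbTE n2] := before_far qn xn un vn h1 h2 h3.
have nq : (q, x) != (v, u).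
  by apply: contraTneq h2 => -[-> _]; rewrite steps_xx.
by have := s_comparable iqx ivu nq; rewrite n1 n2.
Qed.

(** In a convex polygon q, q1, ..., x whose closing side {q, x} occurs in both
orientations, the arc (q, x) forces all the sides that do not touch it to be
forward, and then the rules for consecutive sides make (x, q) precede
itself. *)
Section Polygon.
Variable q : nat.
(* Points increase along the polygon when read from q. *)
Local Notation cyc := (fun a b => steps n q a < steps n q b).

Lemma cyc_last u v l : path cyc u (v :: l) -> steps n q u < steps n q (last v l).
Proof.
elim: l u v => [|w l IHl] u v /=; first by rewrite andbT.
move=> /andP[uv vw]; apply: ltn_trans uv _; exact: IHl vw.
Qed.

(** From a forward arc onwards the precedences run along the sides up to the
closing one. *)
Lemma prec_arrive t u l x : (t, u) \in s -> steps n q t < steps n q u ->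
  path cyc u l -> path adj u l -> l != [::] -> last u l = x ->
  (q, x) \in s -> (x, q) \in s -> prec (t, u) (x, q).
Proof.
move=> + + + + + + iqx ixq; have /and3P[/= qn xn _] := s_arc iqx.
elim: l t u => [//|v l IHl] t u itu tu /= /andP[uv pl] /andP[auv al] _ lx.
have /andP[un vn] := adj_lt auv.
have /and3P[/= tn _ _] := s_arc itu.
have /andP[tu0 tuv] : 0 < steps n t u < steps n t v.
  by apply: (@steps_cycle n q) => //; rewrite tu.
case: l => [|w l] in IHl pl al lx *.
  rewrite /= in lx; subst v.
  have [e ie e_ux] := adj_arc auv.
  apply: prec_trans (prec_fwd_l tuv tu0 itu ie e_ux) _.
  have qux : 0 < steps n q u < steps n q x by rewrite uv (leq_ltn_trans _ tu).
  by have /andP[h1 h2] := steps_rotate qn un xn qux; exact: prec_fwd_r h2 h1 ixq ie e_ux.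
have uvs : (u, v) \in s.
  apply: middle_forward iqx auv _ uv _; first exact: leq_ltn_trans tu.
  by rewrite -lx; exact: cyc_last pl.
apply: prec_trans (IHl u v uvs uv pl al isT lx).
by apply: prec_fwd_l tuv tu0 itu uvs _; left.
Qed.

Lemma polygon_single l x : path cyc q l -> path adj q l -> last q l = x ->
  1 < size l -> ~~ (((q, x) \in s) && ((x, q) \in s)).
Proof.
case: l => [//|q1 [//|q2 l]] /= /and3P[c1 c2 cl] /and3P[a1 a2 al] lx _.
apply/negP => /andP[iqx ixq].
have /and3P[/= qn xn qx] := s_arc iqx.
have /andP[_ q1n] := adj_lt a1; have /andP[_ q2n] := adj_lt a2.
have q1x : steps n q q1 < steps n q x.
  by rewrite -lx; apply: (@cyc_last _ q2) => /=; rewrite c2.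
have q0 : steps n q q = 0 by rewrite steps_xx.
have first_lt e : e \in s -> e = (q, q1) \/ e = (q1, q) -> prec (x, q) e.
  move=> ie h; have c1x : 0 < steps n q q1 < steps n q x by rewrite q1x -{1}q0 c1.
  have /andP[h1 h2] := steps_rotate q1n xn qn (steps_rotate qn q1n xn c1x).
  exact: prec_fwd_l h2 h1 ixq ie h.
case/orP: a1 => i1.
  have h1 := first_lt _ i1 (or_introl erefl).
  have := @prec_arrive q q1 (q2 :: l) x i1 c1 _ _ isT lx iqx ixq.
  rewrite /= c2 cl a2 al => /(_ isT isT) /(prec_trans h1).
  by rewrite prec_irr.
have h1 := first_lt _ i1 (or_intror erefl).
case: l => [|q3 l] in cl al lx *.
  rewrite /= in lx; subst q2; case/orP: a2 => i2.
    have h2 : prec (q1, q) (q1, x).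
      by apply: (@prec_fwd_r q) => //; [rewrite -q0 | right].
    have h3 : prec (q1, x) (x, q).
      by apply: prec_head => //; apply: contraTneq c1 => ->; rewrite ltnn.
    by have := prec_trans h1 (prec_trans h2 h3); rewrite prec_irr.
  (* A triangle with three backward sides is a directed cycle. *)
  have h2 : prec (x, q1) (q1, q) by apply: prec_head => //; rewrite eq_sym.
  have h3 : prec (q1, q) (q, x).
    by apply: prec_head => //; apply: contraTneq q1x => ->; rewrite ltnn.
  have h4 : prec (q, x) (x, q1).
    by apply: prec_head => //; apply: contraTneq c1 => <-; rewrite ltnn.
  by have := prec_trans h2 (prec_trans h3 h4); rewrite prec_irr.
have i2 : (q1, q2) \in s.
  apply: middle_forward iqx a2 _ c2 _; first by rewrite -q0.
  by rewrite -lx; apply: cyc_last cl.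
have h2 : prec (q1, q) (q1, q2).
  by apply: (@prec_fwd_r q) => //; [rewrite -q0 | right].
have h3 := @prec_arrive q1 q2 (q3 :: l) x i2 c2 cl al isT lx iqx ixq.
by have := prec_trans h1 (prec_trans h2 h3); rewrite prec_irr.
Qed.
End Polygon.

(** * Counting arcs *)

(** Arcs are counted inside intervals [a, b] of 0, ..., n - 1, the circle being
cut between n - 1 and 0. *)
Definition in_range a b (e : nat * nat) :=
  (a <= minn e.1 e.2) && (maxn e.1 e.2 <= b).
Definition narcs a b := count (in_range a b) s.
Definition multiplicity a b := ((a, b) \in s) + ((b, a) \in s).
Definition doubled a b := forall x y,
  in_range a b (x, y) -> (x, y) \in s -> (y, x) \in s.
(** In a noncrossing graph, a and b are linked inside [a, b] when some monotone
path does it. *)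
Definition chain a b := exists l, [/\ path ltn a l, path adj a l & last a l = b].

Lemma multE a b : a != b ->
  multiplicity a b = count (fun e => (e == (a, b)) || (e == (b, a))) s.
Proof.
move=> ab.
have e0 : count (predI (pred1 (a, b)) (pred1 (b, a))) s = 0.
  rewrite -(count_pred0 s); apply: eq_count => e /=.
  by apply/andP => -[/eqP -> /eqP [e' _]]; rewrite e' eqxx in ab.
by rewrite /multiplicity -!count_uniq_mem ?s_uniq // -count_predUI e0 addn0.
Qed.

Lemma adj_mult a b : adj a b = (0 < multiplicity a b).
Proof. by rewrite /adj /multiplicity; do 2 case: (_ \in s). Qed.

Lemma count_split3 (T : eqType) (p p1 p2 p3 : pred T) (t : seq T) :
  {in t, forall e, (p e : nat) = p1 e + p2 e + p3 e} ->
  count p t = count p1 t + count p2 t + count p3 t.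
Proof.
elim: t => [//|e t IHt] h /=; rewrite h ?mem_head // IHt; first by lia.
by move=> f ft; apply: h; rewrite inE ft orbT.
Qed.

Lemma s_neq a b : (a, b) \in s -> a != b.
Proof. by move=> /s_arc /and3P[]. Qed.

Lemma range_split a c b u v : a < b -> u < v -> a < c -> c < b ->
  ~~ [&& a < u, u < c & c < v] -> ~~ [&& u == a, c < v & v < b] ->
  (a <= u) && (v <= b) =
  (a <= u) && (v <= c) + (c <= u) && (v <= b) + (u == a) && (v == b) :> nat.
Proof.
move=> ab uv ac cb; case: (ltngtP a u) => au; case: (ltngtP v b) => vb;
  case: (ltngtP c u) => cu; case: (ltngtP v c) => vc //=; lia.
Qed.

Lemma edge_eqE a b x y : a < b ->
  ((x, y) == (a, b)) || ((x, y) == (b, a)) = (minn x y == a) && (maxn x y == b).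
Proof. by move=> ab; rewrite !xpair_eqE /minn /maxn; case: ltnP => xy; lia. Qed.

(** When c is the last neighbour of a before b, no edge inside [a, b] jumps over c
except perhaps {a, b}. *)
Lemma in_range_split a c b e : a < c -> c < b -> adj a c ->
  (forall d, c < d -> d < b -> ~~ adj a d) -> e \in s ->
  in_range a b e = in_range a c e + in_range c b e + ((e == (a, b)) || (e == (b, a))) :> nat.
Proof.
case: e => x y ac cb aac cmax ixy; have nxy := s_neq ixy.
have axy : adj (minn x y) (maxn x y).
  by rewrite /minn /maxn; case: ltnP; rewrite /adj ixy ?orbT.
have ab := ltn_trans ac cb; rewrite (edge_eqE x y ab) /in_range /=.
have xy : minn x y < maxn x y by lia.
apply: range_split => //.
  by apply/negP => /and3P[h1 h2 h3]; have := noncrossing h1 h2 h3 aac; rewrite axy.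
by apply/negP => /and3P[/eqP h1 h2 h3]; have := cmax _ h2 h3; rewrite -h1 axy.
Qed.

Lemma narcs_split a c b : a < c -> c < b -> adj a c ->
  (forall d, c < d -> d < b -> ~~ adj a d) ->
  narcs a b = narcs a c + narcs c b + multiplicity a b.
Proof.
move=> ac cb aac cmax; rewrite multE; last by rewrite ltn_eqF // (ltn_trans ac).
by apply: count_split3 => e; exact: in_range_split.
Qed.

Lemma in_range_isolated a b e : a < b -> (forall d, a < d -> d < b -> ~~ adj a d) ->
  e \in s -> in_range a b e = in_range a.+1 b e + ((e == (a, b)) || (e == (b, a))) :> nat.
Proof.
case: e => x y ab iso ixy; have nxy := s_neq ixy.
have axy : adj (minn x y) (maxn x y).
  by rewrite /minn /maxn; case: ltnP; rewrite /adj ixy ?orbT.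
rewrite (edge_eqE x y ab) /in_range /=.
have xy : minn x y < maxn x y by lia.
have : ~~ [&& minn x y == a, a < maxn x y & maxn x y < b].
  by apply/negP => /and3P[/eqP h1 h2 h3]; have := iso _ h2 h3; rewrite -h1 axy.
move: (minn x y) (maxn x y) xy => u v uv.
by case: (ltngtP a u) => au; case: (ltngtP v b) => vb //=; lia.
Qed.

Lemma narcs_isolated a b : a < b -> (forall d, a < d -> d < b -> ~~ adj a d) ->
  narcs a b = narcs a.+1 b + multiplicity a b.
Proof.
move=> ab iso; rewrite multE ?ltn_eqF // -[narcs a.+1 b]addn0 -(count_pred0 s).
by apply: count_split3 => e ie; rewrite addn0; exact: in_range_isolated.
Qed.

Lemma mult_edge a b x y : multiplicity a b != 1 ->
  ((x, y) == (a, b)) || ((x, y) == (b, a)) -> (x, y) \in s -> (y, x) \in s.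
Proof.
by rewrite /multiplicity => m1 /orP[] /eqP[-> ->] h; move: m1; rewrite h;
  case: (_ \in s).
Qed.

(** The bound 2 * d would be lost if the edge {a, b} were added to a complete
interval.  It survives by induction because either a and b are not linked
inside the interval, and then two arcs are missing, or the new edge closes a
polygon, whose sides occur in one orientation only.  The clauses on
[doubled] contradict equality in the latter case. *)
Definition count_bound d a b :=
  [/\ narcs a b <= 2 * d,
      narcs a b = 2 * d -> doubled a b,
      ~ chain a b -> narcs a b + 2 <= 2 * d &
      ~ chain a b -> narcs a b + 2 = 2 * d -> doubled a b].

Lemma chain_refl a : chain a a.
Proof. by exists [::]. Qed.

Lemma chain_cons a c b : a < c -> adj a c -> chain c b -> chain a b.
Proof. by move=> ac aac [l [h1 h2 h3]]; exists (c :: l); split; rewrite //= ?ac ?aac. Qed.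

Lemma doubled_mult a b x y : doubled a b -> in_range a b (x, y) -> multiplicity x y != 1.
Proof.
move=> h r; have h1 := h x y r; have h2 := h y x.
rewrite /in_range /= minnC maxnC in h2; have := h2 r; move: h1; rewrite /multiplicity.
by case: ((x, y) \in s); case: ((y, x) \in s) => // h1 h2'; [case: (h1 isT) | case: (h2' isT)].
Qed.

(** The polygon consists of {a, c}, a monotone path from c to b and {b, a}.  Its
three kinds of sides are reached by reading it from c, from a and from the
second vertex of the path. *)
Lemma polygon_mult a c b : a < c -> c < b -> adj a c -> adj a b -> chain c b ->
  [/\ multiplicity a c <= 1, multiplicity a b <= 1 & ~ doubled c b].
Proof.
move=> ac cb aac aab [l [cl al lb]].
have /andP[_ bn] := adj_lt aab.
have offE q x : q <= x -> steps n q x = x - q by move=> qx; rewrite /steps qx.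
have offE' q x : x < q -> steps n q x = x + n - q.
  by move=> xq; rewrite /steps leqNgt xq.
have up q u t : q <= u -> path ltn u t -> all (geq b) t ->
    path (fun x y => steps n q x < steps n q y) u t.
  elim: t u => [//|v t IHt] u qu /= /andP[uv pt] /andP[_ ht].
  rewrite !offE ?(ltnW (leq_ltn_trans qu uv)) // ltn_sub2r ?uv //=; last first.
    exact: leq_ltn_trans uv.
  by apply: IHt => //; exact: ltnW (leq_ltn_trans qu uv).
have le_last u t : path ltn u t -> all (geq (last u t)) t.
  elim: t u => [//|v t IHt] u /= /andP[uv pt]; rewrite IHt // andbT /=.
  case: t pt {IHt} => [//|w t] pt.
  by have := order_path_min ltn_trans pt => /allP /(_ _ (mem_last w t)) /ltnW.
have lb_l : all (geq b) l by rewrite -lb; exact: le_last.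
have l0 : l != [::] by apply: contraTneq cb => l0; rewrite -lb l0 ltnn.
have mult2 x y : ((x, y) \in s) && ((y, x) \in s) = (1 < multiplicity x y).
  by rewrite /multiplicity; do 2 case: (_ \in s).
have aba : adj b a by rewrite adj_sym.
split.
- rewrite leqNgt -mult2 andbC.
  apply: (@polygon_single c (rcons l a)); rewrite ?last_rcons ?size_rcons //.
  + rewrite rcons_path up //= lb offE ?(ltnW cb) // offE' //; lia.
  + by rewrite rcons_path al lb.
  + by case: (l) l0.
- rewrite leqNgt -mult2; apply: (@polygon_single a (c :: l)) => //=.
  + rewrite up ?(ltnW ac) // andbT !offE ?(ltnW ac) //; lia.
  + by rewrite aac al.
  + by case: (l) l0.
case: l l0 => [//|p l] _ in cl al lb lb_l *.
move=> dbl; rewrite /= in lb; move: cl al => /= /andP[cp pl] /andP[acp al].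
have lb_l' : all (geq b) l by case/andP: lb_l.
have pb : p <= b by case/andP: lb_l.
have : ~~ (((p, c) \in s) && ((c, p) \in s)).
  apply: (@polygon_single p (rcons (rcons l a) c)); rewrite ?last_rcons ?size_rcons //.
    rewrite !rcons_path !last_rcons up //= lb offE // !offE' ?(ltn_trans ac) //; lia.
  by rewrite !rcons_path last_rcons al lb /= aba aac.
by case/orP: acp => h; rewrite h (dbl _ _ _ h) //; rewrite /in_range /=; lia.
Qed.

(** Induction on the length of [a, b], cutting at the last neighbour of a before b. *)
Lemma count_boundP d a b : a + d = b -> b < n -> count_bound d a b.
Proof.
elim/ltn_ind: d a b => d IHd a b adb bn.
have [d0|d_gt0] := posnP d.
  have -> : b = a by lia.
  have e0 : narcs a a = 0.
    apply/eqP; rewrite -leqn0 leqNgt -has_count; apply/hasPn => -[x y] /s_neq /=.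
    by rewrite /in_range /=; lia.
  rewrite /count_bound e0 d0; split => //.
  - by move=> _ x y; rewrite /in_range /= => xy /s_neq; lia.
  - by case; exact: chain_refl.
have ab : a < b by lia.
have m2 : multiplicity a b <= 2 by rewrite /multiplicity; do 2 case: (_ \in s).
have m0 : ~ chain a b -> multiplicity a b = 0.
  move=> nch; apply/eqP; rewrite -leqn0 leqNgt -adj_mult; apply/negP => aab.
  by apply: nch; exact: chain_cons ab aab (chain_refl b).
case: (pickP (fun c : 'I_b => (a < c) && adj a c)) => [c0 hc0|noc]; last first.
  have noc' e : a < e -> e < b -> ~~ adj a e.
    by move=> ae eb; have := noc (Ordinal eb); rewrite /= ae /= => ->.
  have E := narcs_isolated ab noc'.
  have [h1 h2 h3 h4] := IHd d.-1 ltac:(lia) a.+1 b ltac:(lia) bn.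
  have dbl : doubled a.+1 b -> multiplicity a b != 1 -> doubled a b.
    move=> db m1 x y r ixy; move: (in_range_isolated ab noc' ixy); rewrite r.
    case: (boolP (in_range a.+1 b (x, y))) => [r' _|_]; first exact: db.
    by case: (boolP (_ || _)) => // e _; exact: mult_edge e ixy.
  split.
  - by lia.
  - by move=> e; apply: dbl; [apply: h2 | ]; lia.
  - by move=> /m0; lia.
  - by move=> /m0 mab e; apply: dbl; [apply: h2 | ]; lia.
pose c := [arg max_(c > c0 | (a < c) && adj a c) (c : nat)].
have [ac aac cb cmax] : [/\ a < c, adj a c, c < b & forall e, c < e -> e < b -> ~~ adj a e].
  rewrite /c; case: arg_maxnP => // e /andP[ae aae] emax; split => // f ef fb.
  apply/negP => aaf; have := emax (Ordinal fb); rewrite /= aaf (ltn_trans ae ef).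
  by move=> /(_ isT); rewrite leqNgt ef.
move: (c : nat) ac aac cb cmax => {c0 hc0} {}c ac aac cb cmax.
have E := narcs_split ac cb aac cmax.
have [h1 h2 _ _] := IHd (c - a) ltac:(lia) a c ltac:(lia) ltac:(lia).
have [k1 k2 k3 k4] := IHd (b - c) ltac:(lia) c b ltac:(lia) bn.
have dbl : doubled a c -> doubled c b -> multiplicity a b != 1 -> doubled a b.
  move=> da dc m1 x y r ixy; move: (in_range_split ac cb aac cmax ixy); rewrite r.
  case: (boolP (in_range a c (x, y))) => [r' _|_]; first exact: da.
  case: (boolP (in_range c b (x, y))) => [r' _|_]; first exact: dc.
  by case: (boolP (_ || _)) => // e _; exact: mult_edge e ixy.
have ch_ab : chain c b -> chain a b := chain_cons ac aac.
have [ch|nch] := pselect (chain c b); last first.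
  split.
  - by have := k3 nch; lia.
  - move=> e; have := k3 nch => k3'.
    by apply: dbl; [apply: h2; lia | apply: k4 => //; lia | lia].
  - by move=> /m0; have := k3 nch; lia.
  - move=> /m0 mab e; have := k3 nch => k3'.
    by apply: dbl; [apply: h2; lia | apply: k4 => //; lia | lia].
have [aab|naab] := boolP (adj a b); last first.
  have mab : multiplicity a b = 0 by move: naab; rewrite adj_mult -leqNgt leqn0 => /eqP.
  split; try by move=> /(_ (ch_ab ch)).
  - by lia.
  - by move=> e; apply: dbl; [apply: h2; lia | apply: k2; lia | lia].
have [mac mab ndbl] := polygon_mult ac cb aac aab ch.
have nac : narcs a c != 2 * (c - a).
  apply/eqP => /h2 da; have := doubled_mult (x := a) (y := c) da.
  rewrite /in_range /= (minn_idPl (ltnW ac)) (maxn_idPr (ltnW ac)) !leqnn => /(_ isT).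
  by rewrite adj_mult in aac; lia.
have ncb : narcs c b != 2 * (b - c) by apply/eqP => /k2.
split; try by move=> /(_ (ch_ab ch)).
- by lia.
- by move=> e; exfalso; lia.
Qed.

Lemma narcs_all : narcs 0 n.-1 = size s.
Proof.
apply/eqP; rewrite -all_count; apply/allP => -[x y] /s_arc /and3P[/= xn yn _].
by rewrite /in_range /=; lia.
Qed.

Lemma size_collection : 0 < n -> size s <= 2 * n.-1.
Proof.
move=> n0; rewrite -narcs_all.
by case: (@count_boundP n.-1 0 n.-1 (add0n _) ltac:(lia)).
Qed.

Lemma full_symmetric : 0 < n -> size s = 2 * n.-1 ->
  forall x y, (x, y) \in s -> (y, x) \in s.
Proof.
move=> n0; rewrite -narcs_all => e x y ixy.
have [_ dbl _ _] := @count_boundP n.-1 0 n.-1 (add0n _) ltac:(lia).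
apply: dbl (ixy) => //; have /and3P[/= xn yn _] := s_arc ixy.
by rewrite /in_range /=; lia.
Qed.

Lemma no_cycle3 x y z : (x, y) \in s -> (y, z) \in s -> (z, x) \in s -> False.
Proof.
move=> xy yz zx.
have h1 : prec (x, y) (y, z) by apply: prec_head => //; rewrite eq_sym s_neq.
have h2 : prec (y, z) (z, x) by apply: prec_head => //; rewrite eq_sym s_neq.
have h3 : prec (z, x) (x, y) by apply: prec_head => //; rewrite eq_sym s_neq.
by have := prec_trans h1 (prec_trans h2 h3); rewrite prec_irr.
Qed.

Section Symmetric.
Hypothesis s_sym : forall x y, (x, y) \in s -> (y, x) \in s.

(** Two doubled edges without common endpoint either cross or have orientations
with disjoint complements. *)
Lemma edges_meet_ordered x y z t : (x, y) \in s -> (z, t) \in s ->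
  x < y -> z < t -> x < z -> (y == z) || (y == t).
Proof.
move=> ixy izt xy zt xz; apply: contraT; rewrite negb_or => /andP[yz yt].
have /and3P[/= xn yn _] := s_arc ixy; have /and3P[/= zn tn _] := s_arc izt.
have axy : adj x y by rewrite /adj ixy.
case: (ltngtP y z) yz => // yz _.
  have ne : (y, x) != (t, z) by rewrite xpair_eqE negb_and yt.
  have := s_comparable (s_sym ixy) (s_sym izt) ne.
  have /andP[/negbTE -> /negbTE -> //] := @before_far n y z t x yn xn zn tn
    ltac:(by rewrite /steps; solve_off) ltac:(by rewrite /steps; solve_off)
    ltac:(by rewrite /steps; solve_off).
case: (ltngtP y t) yt => // yt _.
  by have := noncrossing xz yz yt axy; rewrite /adj izt.
have ne : (x, y) != (t, z) by rewrite xpair_eqE negb_and; lia.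
have := s_comparable ixy (s_sym izt) ne.
by have /andP[/negbTE -> /negbTE -> //] := @before_far n x z t y xn yn zn tn
    ltac:(by rewrite /steps; solve_off) ltac:(by rewrite /steps; solve_off)
    ltac:(by rewrite /steps; solve_off).
Qed.

Lemma edges_meet x y z t : (x, y) \in s -> (z, t) \in s ->
  [|| x == z, x == t, y == z | y == t].
Proof.
wlog xy : x y / x < y => [W ixy izt|].
  case: (ltngtP x y) (s_neq ixy) => // xy _; first exact: W.
  by have := W y x xy (s_sym ixy) izt; lia.
wlog zt : z t / z < t => [W ixy izt|].
  case: (ltngtP z t) (s_neq izt) => // zt _; first exact: W.
  by have := W t z zt ixy (s_sym izt); lia.
move=> ixy izt; case: (ltngtP x z) => //= xz.
  by have /orP[-> | ->] := edges_meet_ordered ixy izt xy zt xz; rewrite ?orbT.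
by have /orP[] := edges_meet_ordered izt ixy zt xy xz => /eqP ->; rewrite eqxx ?orbT.
Qed.

(** All edges meet a given edge {x, y}.  If one of them misses x and another one
misses y, then these two meet and close a triangle with {x, y}. *)
Lemma star_center : 0 < size s ->
  exists2 v, v < n & forall x y, (x, y) \in s -> (x == v) || (y == v).
Proof.
move=> s0; have [x [y ixy]] : exists x y, (x, y) \in s.
  by case: s s0 => [//|[x y] t] _; exists x, y; rewrite mem_head.
have /and3P[/= xn yn xy] := s_arc ixy.
have [h|] := pselect (forall z t, (z, t) \in s -> (z == x) || (t == x)).
  by exists x.
move=> /existsNP [z0 /existsNP [t0 /not_implyP [izt0 /negP]]].
rewrite negb_or => /andP[zx0 tx0].
have [z [iyz zx]] : exists z, (y, z) \in s /\ z != x.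
  have := edges_meet ixy izt0; rewrite ![x == _]eq_sym (negbTE zx0) (negbTE tx0) /=.
  by case/orP => /eqP ->; [exists t0 | exists z0]; split => //; exact: s_sym.
exists y => // a b iab; apply: contraT; rewrite negb_or => /andP[ay by_].
have xz : (x, z) \in s.
  have := edges_meet ixy iab; rewrite ![y == _]eq_sym (negbTE ay) (negbTE by_) !orbF.
  have := edges_meet iyz iab; rewrite ![y == _]eq_sym (negbTE ay) (negbTE by_) /=.
  have iba := s_sym iab.
  by move=> /orP[]/eqP ez /orP[]/eqP ex; rewrite ex ez // in zx *; rewrite eqxx in zx.
by exfalso; apply: (no_cycle3 ixy iyz (s_sym xz)).
Qed.
End Symmetric.
End Collections.

(** * Stars *)

Section Stars.
Variables (n v : nat).
Hypothesis v_lt : v < n.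

(** Listing the points other than v as v - 1, v - 2, ..., v + 1 puts the arcs that
end at v in increasing order of length, and those that start at v in
decreasing order. *)
Definition others := sort (fun x y => steps n v y <= steps n v x)
  [seq x <- iota 0 n | x != v].

Definition star := [seq (x, v) | x <- others] ++ [seq (v, x) | x <- others].

Lemma mem_others x : (x \in others) = (x < n) && (x != v).
Proof. by rewrite mem_sort mem_filter mem_iota add0n andbC. Qed.

Lemma size_others : size others = n.-1.
Proof.
rewrite size_sort size_filter; have := count_predC (pred1 v) (iota 0 n).
rewrite size_iota (_ : count (pred1 v) _ = 1) => [|]; last first.
  by rewrite count_uniq_mem ?iota_uniq // mem_iota add0n v_lt.
by rewrite add1n => /(congr1 predn).
Qed.

Lemma size_star : size star = 2 * n.-1.
Proof. by rewrite size_cat !size_map size_others mul2n addnn. Qed.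

Lemma steps_inj x y : x < n -> y < n -> steps n v x = steps n v y -> x = y.
Proof. by have := stepsP n v x; have := stepsP n v y; lia. Qed.

Lemma others_decreasing : pairwise (fun x y => steps n v y < steps n v x) others.
Proof.
have tr : transitive (fun x y => steps n v y <= steps n v x).
  by move=> y x z xy yz; exact: leq_trans yz xy.
have h1 : pairwise (fun x y => steps n v y <= steps n v x) others.
  rewrite -sorted_pairwise //; apply: sort_sorted => x y; exact: leq_total.
have h2 : pairwise (fun x y => x != y) others.
  by rewrite -uniq_pairwise sort_uniq filter_uniq // iota_uniq.
have : pairwise [rel x y | (steps n v y <= steps n v x) && (x != y)] others.
  by rewrite pairwise_relI h1 h2.
apply: (sub_in_pairwise (P := mem others)) (allss _) => x y.
rewrite !mem_others => /andP[xn _] /andP[yn _] /= /andP[le ne].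
rewrite ltn_neqAle le andbT; apply: contraNneq ne => e.
by rewrite (steps_inj yn xn e).
Qed.

Lemma star_arc e : e \in star -> is_arc n e.
Proof.
rewrite mem_cat => /orP[] /mapP [x]; rewrite mem_others => /andP[xn xv] ->.
  by rewrite /is_arc /= xn v_lt.
by rewrite /is_arc /= xn v_lt eq_sym.
Qed.

Lemma star_before : pairwise (before n) star.
Proof.
have vv x : x \in others -> is_arc n (v, x) /\ is_arc n (x, v).
  by rewrite mem_others => /andP[xn xv]; rewrite /is_arc /= xn v_lt xv eq_sym xv.
rewrite pairwise_cat !pairwise_map; apply/and3P; split.
- apply/allrelP => a b /mapP [x /vv [_ h] ->] /mapP [y /vv [h' _] ->].
  exact: before_head.
- apply: (sub_in_pairwise (P := mem others)) (allss _) others_decreasing.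
  move=> x y hx hy /= lt; have [[h1 h2] [h3 h4]] := (vv x hx, vv y hy).
  rewrite before_end //; move: hx hy lt; rewrite !mem_others.
  by have := stepsP n v x; have := stepsP n v y; have := stepsP n x v;
     have := stepsP n y v; lia.
- apply: (sub_in_pairwise (P := mem others)) (allss _) others_decreasing.
  move=> x y hx hy /= lt; have [[h1 h2] [h3 h4]] := (vv x hx, vv y hy).
  by rewrite before_start.
Qed.

End Stars.

(** Equality in the bound makes all edges doubled; they pairwise meet and form no
triangle, so they pass through one point.  The order of the arcs at that
point is forced, because consecutive arcs of the star are allowed in
one order only. *)
Lemma full_star n s : 2 < n -> (forall e, e \in s -> is_arc n e) ->
  pairwise (before n) s -> size s = 2 * n.-1 -> exists2 v, v < n & s = star n v.
Proof.
move=> n3 s_arc s_bef s_size.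
have s_sym := full_symmetric s_arc s_bef ltac:(lia) s_size.
have s_gt0 : 0 < size s by rewrite s_size; lia.
have [v vn cv] := star_center s_arc s_bef s_sym s_gt0.
exists v => //.
have us := s_uniq s_arc s_bef.
have sub : {subset s <= star n v}.
  move=> [x y] ixy; have /and3P[/= xn yn xy] := s_arc _ ixy.
  rewrite mem_cat; case/orP: (cv _ _ ixy) => /eqP e; subst v; apply/orP.
    by right; apply: map_f; rewrite mem_others yn eq_sym.
  by left; apply: (map_f (fun x => (x, y))); rewrite mem_others xn.
have [_ mem_eq] := uniq_min_size us sub ltac:(by rewrite size_star ?s_size).
apply: (irr_sorted_eq (leT := prec s)) => //.
- exact: prec_trans.
- exact: prec_irr.
- rewrite sorted_pairwise; last exact: prec_trans.
  apply/(pairwiseP (0, 0)) => i j; rewrite !inE => ia ja ij.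
  by rewrite /prec !index_uniq.
have dec := others_decreasing vn.
have ina x : x \in others n v -> (x, v) \in s.
  by move=> hx; rewrite mem_eq mem_cat (map_f (fun x => (x, v))).
have outa x : x \in others n v -> (v, x) \in s.
  by move=> hx; rewrite mem_eq mem_cat map_f ?orbT.
have sorted_in : sorted (prec s) [seq (x, v) | x <- others n v].
  rewrite sorted_map; apply: pairwise_sorted.
  apply: (sub_in_pairwise (P := mem (others n v))) (allss _) dec => x y hx hy /= lt.
  apply: (prec_end s_arc s_bef) => //; try exact: ina.
  have := hx; have := hy; rewrite !mem_others; move: lt.
  by have := stepsP n v x; have := stepsP n v y; have := stepsP n x v;
     have := stepsP n y v; lia.
have sorted_out : sorted (prec s) [seq (v, x) | x <- others n v].
  rewrite sorted_map; apply: pairwise_sorted.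
  apply: (sub_in_pairwise (P := mem (others n v))) (allss _) dec => x y hx hy /= lt.
  by apply: (prec_start s_arc s_bef) => //; exact: outa.
have so : 1 < size (others n v) by rewrite size_others //; lia.
have uo : uniq (others n v).
  by rewrite sort_uniq filter_uniq // iota_uniq.
rewrite /star; move: so sorted_in sorted_out uo ina outa.
case: (others n v) => [|x0 [|x1 t]] //= _ /andP[i1 i2] /andP[o1 o2] /andP[x0t _] ina outa.
rewrite cat_path i1 i2 /= o1 o2 !andbT last_map.
apply: (prec_head s_arc s_bef); first exact/ina/mem_behead/mem_last.
  exact/outa/mem_head.
by apply: contraNneq x0t => <-; exact: mem_last.
Qed.

Import Order.TTheory GRing.Theory Num.Theory.
Local Open Scope classical_set_scope.
Local Open Scope card_scope.
Local Open Scope ring_scope.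

(** * Homomorphisms and extensions over an algebra *)

Local Notation "a ** x" := (fdmod_act _ a x) (at level 40).

Section Action.
Variables (K : fieldType) (A : falgType K).
Implicit Types M N : fdmod A.

Lemma act_1 M (x : M) : 1 ** x = x.
Proof. by rewrite fdmod_act1 id_lfunE. Qed.

Lemma act_M M (a b : A) (x : M) : (a * b) ** x = a ** (b ** x).
Proof. by rewrite fdmod_actM comp_lfunE. Qed.

Lemma act_0 M (x : M) : 0 ** x = 0.
Proof. by rewrite linear0 zero_lfunE. Qed.

Lemma act_Z M (c : K) (a : A) (x : M) : (c *: a) ** x = c *: (a ** x).
Proof. by rewrite linearZ scale_lfunE. Qed.

Lemma act_sum M (I : finType) (F : I -> A) (x : M) :
  (\sum_i F i) ** x = \sum_i F i ** x.
Proof. by rewrite linear_sum sum_lfunE. Qed.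

Lemma act_XD M (a : A) (s t : nat) (x : M) :
  a ^+ (s + t) ** x = a ^+ s ** (a ^+ t ** x).
Proof. by rewrite exprD act_M. Qed.

Lemma hom_comp M N (P : fdmod A) (f : 'Hom(M, N)) (g : 'Hom(N, P)) :
  is_hom f -> is_hom g -> is_hom (g \o f)%VF.
Proof. by move=> hf hg a x; rewrite !comp_lfunE hf hg. Qed.

Lemma hom_id M : is_hom (\1%VF : 'Hom(M, M)).
Proof. by move=> a x; rewrite !id_lfunE. Qed.

Lemma hom_inv M N (f : 'Hom(M, N)) : is_hom f -> lker f = 0%VS ->
  limg f = fullv -> is_hom (f^-1)%VF.
Proof.
move=> hf kf lf a y.
have /memv_imgP [x _ ->] : y \in limg f by rewrite lf memvf.
by rewrite -hf !lker0_lfunK // kf.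
Qed.

Lemma iso_refl M : iso M M.
Proof.
exists \1%VF; first exact: hom_id.
split; last by rewrite lim1g.
by apply/eqP/lker0P => x y; rewrite !id_lfunE.
Qed.

Lemma iso_sym M N : iso M N -> iso N M.
Proof.
move=> [f hf [kf lf]].
have fK : cancel f (f^-1)%VF by apply: lker0_lfunK; rewrite kf.
have fVK : cancel (f^-1)%VF f.
  by move=> y; have /memv_imgP [x _ ->] : y \in limg f; rewrite ?fK // lf memvf.
exists (f^-1)%VF; first exact: hom_inv.
split; first by apply/eqP/lker0P; exact: can_inj fVK.
by apply/vspaceP => x; rewrite memvf -[x]fK memv_img // memvf.
Qed.

Lemma iso_trans M N (P : fdmod A) : iso M N -> iso N P -> iso M P.
Proof.
move=> [f hf [kf lf]] [g hg [kg lg]].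
exists (g \o f)%VF; first exact: hom_comp.
split; last by rewrite limg_comp lf.
apply/eqP/lker0P => x y; rewrite !comp_lfunE.
by move=> /(lker0P (introT eqP kg)) /(lker0P (introT eqP kf)).
Qed.

Lemma eq_iso_class M N : iso_class M = iso_class N <-> iso M N.
Proof.
split=> [eMN|iMN].
  by have : iso_class N N := iso_refl N; rewrite -eMN.
apply/seteqP; split=> P /=; last exact: iso_trans.
by apply: iso_trans; exact: iso_sym.
Qed.

Lemma homA0P M N : homA M N = 0%VS <-> forall f : 'Hom(M, N), is_hom f -> f = 0.
Proof.
split=> [h f /memv_homA|h]; first by rewrite h memv0 => /eqP.
apply/eqP; rewrite -subv0; apply/subvP => f /memv_homA /h ->.
exact: mem0v.
Qed.

Lemma iso_homA0 M M' N N' : iso M M' -> iso N N' ->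
  homA M N = 0%VS -> homA M' N' = 0%VS.
Proof.
move=> [f hf [kf lf]] /iso_sym [g hg [kg lg]] /homA0P h; apply/homA0P => u hu.
apply/lfunP => y; rewrite zero_lfunE.
have /memv_imgP [x _ ->] : y \in limg f by rewrite lf memvf.
apply: (lker0P (introT eqP kg)); rewrite linear0.
have /lfunP /(_ x) := h _ (hom_comp hf (hom_comp hu hg)).
by rewrite !comp_lfunE zero_lfunE.
Qed.

Lemma iso_ext1_eq0 M M' N N' : iso M M' -> iso N N' ->
  ext1_eq0 M N -> ext1_eq0 M' N'.
Proof.
move=> /iso_sym [f hf [kf lf]] [g hg [kg lg]] h X Y.
have kgi (E : fdmod A) (i : 'Hom(N', E)) : lker i = 0%VS -> lker (i \o g)%VF = 0%VS.
  move=> ki; apply/eqP/lker0P => x y; rewrite !comp_lfunE.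
  by move=> /(lker0P (introT eqP ki)) /(lker0P (introT eqP kg)).
have fE (E : fdmod A) (i : 'Hom(N', E)) (p : 'Hom(E, M')) : limg i = lker p ->
    limg (i \o g)%VF = lker (f \o p)%VF.
  move=> e; rewrite limg_comp lg e; apply/vspaceP => z.
  rewrite !memv_ker comp_lfunE -[X in _ = (_ == X)](linear0 f).
  by rewrite (inj_eq (lker0P (introT eqP kf))).
have lfp (E : fdmod A) (p : 'Hom(E, M')) : limg p = fullv ->
    limg (f \o p)%VF = fullv by rewrite limg_comp => ->.
pose T (Z : extension M' N') : extension M N := Extension
  (hom_comp hg (@ext_inj_hom _ _ _ _ Z)) (hom_comp (@ext_proj_hom _ _ _ _ Z) hf)
  (kgi _ _ (@ext_inj_mono _ _ _ _ Z)) (fE _ _ _ (@ext_exact _ _ _ _ Z))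
  (lfp _ _ (@ext_proj_epi _ _ _ _ Z)).
have [u hu [ui up]] := h (T X) (T Y).
exists u => //; split; apply/lfunP => z.
  have /memv_imgP [x _ ->] : z \in limg g by rewrite lg memvf.
  by have /lfunP /(_ x) := ui; rewrite /= !comp_lfunE.
have /lfunP /(_ z) := up; rewrite /= !comp_lfunE.
exact: (lker0P (introT eqP kf)).
Qed.

(** The identity spans a one dimensional endomorphism space. *)
Lemma brick_hom M (f : 'Hom(M, M)) : \dim (homA M M) = 1%N -> is_hom f ->
  exists c : K, f = c *: \1%VF.
Proof.
move=> d1 hf.
have id1 : (\1%VF : 'Hom(M, M)) \in homA M M by apply/memv_homA; exact: hom_id.
have nz : (\1%VF : 'Hom(M, M)) != 0.
  apply/eqP => e1; have : homA M M = 0%VS; last by move=> h; rewrite h dimv0 in d1.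
  apply/homA0P => g _; apply/lfunP => x; rewrite zero_lfunE.
  by rewrite -[x](id_lfunE x) e1 zero_lfunE linear0.
have e : homA M M = <[\1%VF]>%VS.
  by apply/eqP; rewrite eq_sym eqEdim -memvE id1 d1 dim_vline nz.
have : f \in homA M M by apply/memv_homA.
by rewrite e => /vlineP.
Qed.

(** Given retracts of both middle terms onto the submodule, the identity of N and
the two sections glue to an equivalence. *)
Lemma split_ext1_eq0 M N :
  (forall X : extension M N, exists2 u : 'Hom(M, ext_mid X), is_hom u &
     (ext_proj X \o u)%VF = \1%VF) -> ext1_eq0 M N.
Proof.
move=> h X Y; have [u hu eu] := h X; have [w hw ew] := h Y.
have ei (Z : extension M N) : lker (ext_inj Z) == 0%VS by rewrite ext_inj_mono.
have pi0 (Z : extension M N) y : ext_proj Z (ext_inj Z y) = 0.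
  by apply/eqP; rewrite -memv_ker -ext_exact memv_img // memvf.
have pu x : ext_proj X (u x) = x by rewrite -comp_lfunE eu id_lfunE.
have pw x : ext_proj Y (w x) = x by rewrite -comp_lfunE ew id_lfunE.
pose q := ((ext_inj X)^-1 \o (\1 - (u \o ext_proj X)))%VF.
have qK z : ext_inj X (q z) = z - u (ext_proj X z).
  rewrite /q comp_lfunE add_lfunE opp_lfunE id_lfunE comp_lfunE.
  have /memv_imgP [y _ ->] : z - u (ext_proj X z) \in limg (ext_inj X).
    by rewrite ext_exact memv_ker linearB /= pu subrr.
  by rewrite lker0_lfunK.
have qi y : q (ext_inj X y) = y.
  by apply: (lker0P (ei X)); rewrite qK pi0 linear0 subr0.
clearbody q; exists ((ext_inj Y \o q)%VF + (w \o ext_proj X)%VF); last first.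
  split; apply/lfunP => z; rewrite !comp_lfunE add_lfunE !comp_lfunE.
    by rewrite qi pi0 linear0 addr0.
  by rewrite linearD /= pi0 pw add0r.
move=> a z; rewrite !add_lfunE !comp_lfunE linearD /=.
rewrite (@ext_proj_hom _ _ _ _ X) hw -(@ext_inj_hom _ _ _ _ Y).
congr (ext_inj Y _ + _); apply: (lker0P (ei X)).
by rewrite qK (@ext_inj_hom _ _ _ _ X) qK linearB /= (@ext_proj_hom _ _ _ _ X) hu.
Qed.

End Action.

(** * Modules over the Nakayama algebra *)

Section NakayamaModules.
Variables (K : fieldType) (n k : nat).
Hypotheses (n_gt1 : (1 < n)%N) (k_gt0 : (0 < k)%N) (k_lt_n : (k < n)%N).
Local Notation A := (nakayama K n k).
Implicit Types M N : fdmod A.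

Lemma Zn_natrI (i : 'Z_n) (s t : nat) : (s < n)%N -> (t < n)%N ->
  i + s%:R = i + t%:R -> s = t.
Proof.
move=> hs ht /addrI /(congr1 (@nat_of_ord _)).
by rewrite !val_Zp_nat // !modn_small.
Qed.

(** Starting at a vertex, a path of length t is the power arr ^+ t. *)
Definition arr : A := \sum_i npath K k i 1.

Lemma nakayama_1E : 1 = \sum_i npath K k i 0 :> A.
Proof.
apply/ffunP => -[v r]; rewrite sum_ffunE ffunE (bigD1 v) //= big1 => [|i iv].
  by rewrite addr0 !ffunE /= eqxx.
by rewrite ffunE /= eq_sym (negbTE iv).
Qed.

Lemma nakayamaE (a : A) : a = \sum_p a p *: npath K k p.1 p.2.
Proof.
apply/ffunP => q; rewrite sum_ffunE (bigD1 q) //= big1 => [|p pq].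
  by rewrite addr0 !ffunE !eqxx; exact: esym (mulr1 _).
rewrite !ffunE [_ && _](_ : _ = false) ?scaler0 //; apply/negbTE; move: pq.
by apply: contra => /andP[/eqP e /eqP /val_inj f];
   rewrite [p]surjective_pairing -e -f -surjective_pairing.
Qed.

Lemma npath00 (i j : 'Z_n) :
  npath K k j 0 * npath K k i 0 = (if j == i then npath K k i 0 else 0) :> A.
Proof. by rewrite npathM addr0 addn0 andbT. Qed.

Lemma arrX_npath (i : 'Z_n) t :
  arr ^+ t * npath K k i 0 = (if (t < k)%N then npath K k i t else 0) :> A.
Proof.
elim: t => [|t IHt]; first by rewrite mul1r k_gt0.
rewrite exprS -mulrA IHt; case: ltnP => [tk|kt]; last by rewrite mulr0 ltnNge leqW.
rewrite /arr mulr_suml (bigD1 (i + t%:R)) //= big1 => [|j jit].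
  by rewrite npathM eqxx addn1 prednK // addr0.
by rewrite npathM (negbTE jit).
Qed.

Lemma arrXk : arr ^+ k = 0.
Proof.
rewrite -[LHS]mulr1 nakayama_1E mulr_sumr big1 // => i _.
by rewrite arrX_npath ltnn.
Qed.

Lemma npath_arrX (j : 'Z_n) t :
  npath K k j 0 * arr ^+ t = arr ^+ t * npath K k (j - t%:R) 0.
Proof.
rewrite -[LHS]mulr1 nakayama_1E mulr_sumr (bigD1 (j - t%:R)) //= big1 ?addr0.
  rewrite -mulrA arrX_npath; case: ifP => tk; last by rewrite mulr0.
  by rewrite npathM subrK eqxx addn0 prednK // tk.
move=> i ij; rewrite -mulrA arrX_npath; case: ifP => tk; last by rewrite mulr0.
rewrite npathM; case: eqP => //= e; case/eqP: ij.
by rewrite e addrK.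
Qed.

(** The algebra is generated by the vertices and the sum of the arrows. *)
Lemma hom_nakP M N (f : 'Hom(M, N)) :
  (forall i x, f (npath K k i 0 ** x) = npath K k i 0 ** f x) ->
  (forall x, f (arr ** x) = arr ** f x) -> is_hom f.
Proof.
move=> f0 f1 a x.
have fX t y : f (arr ^+ t ** y) = arr ^+ t ** f y.
  elim: t y => [|t IHt] y; first by rewrite !act_1.
  by rewrite !exprS !act_M f1 IHt.
rewrite [a]nakayamaE !act_sum linear_sum; apply: eq_bigr => p _.
rewrite !act_Z linearZ /=; congr (_ *: _).
have -> : npath K k p.1 p.2 = arr ^+ p.2 * npath K k p.1 0 :> A.
  by rewrite arrX_npath -[X in (_ < X)%N](prednK k_gt0) ltn_ord.
by rewrite !act_M fX f0.
Qed.

Lemma vertex_arrX M (i j : 'Z_n) t (x : M) : npath K k i 0 ** x = x ->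
  npath K k j 0 ** (arr ^+ t ** x) = if j == i + t%:R then arr ^+ t ** x else 0.
Proof.
move=> ex; rewrite -act_M npath_arrX -ex act_M -[X in _ ** X]act_M npath00.
by rewrite subr_eq; case: ifP; rewrite ?act_0 ?linear0.
Qed.

(** * Graded modules *)

(** A vector space with a grading by heights below k and an operator H of degree
one is a module: a vector of height h sits at the vertex i + h, and the sum
of the arrows acts as H, whose kth power vanishes. *)
Section Graded.
Variables (i : 'Z_n) (d : nat) (ht : 'I_d -> nat) (H : 'M[K]_d).
Hypothesis ht_lt : forall c, (ht c < k)%N.
Hypothesis ht_deg : forall r c, H r c != 0 -> ht r = (ht c).+1.

Definition vproj (j : 'Z_n) : 'M[K]_d :=
  \matrix_(r, c) ((r == c) && (i + (ht c)%:R == j))%:R.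

Lemma vprojE (j : 'Z_n) p (B : 'M[K]_(d, p)) r c :
  (vproj j *m B) r c = (i + (ht r)%:R == j)%:R * B r c.
Proof.
rewrite mxE (bigD1 r) //= big1 ?addr0 => [|u ur]; first by rewrite mxE eqxx.
by rewrite mxE eq_sym (negbTE ur) mul0r.
Qed.

Lemma mul_vproj (j : 'Z_n) p (B : 'M[K]_(p, d)) r c :
  (B *m vproj j) r c = B r c * (i + (ht c)%:R == j)%:R.
Proof.
rewrite mxE (bigD1 c) //= big1 ?addr0 => [|u uc]; first by rewrite mxE eqxx.
by rewrite mxE (negbTE uc) mulr0.
Qed.

Lemma vprojM (j l : 'Z_n) : vproj j *m vproj l = if j == l then vproj l else 0.
Proof.
apply/matrixP => r c; rewrite vprojE [vproj l r c]mxE.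
case: (eqVneq r c) => [->|rc] /=; last first.
  by rewrite mulr0; case: ifP; rewrite mxE ?(negbTE rc).
rewrite -natrM mulnb; case: (eqVneq j l) => [->|jl].
  by rewrite andbb mxE eqxx.
rewrite mxE; case: eqP => //= e; case: eqP => //= f.
by case/eqP: jl; rewrite -e -f.
Qed.

Lemma vproj_sum : \sum_j vproj j = 1%:M.
Proof.
apply/matrixP => r c; rewrite summxE (bigD1 (i + (ht c)%:R)) //= big1 ?addr0.
  by rewrite !mxE eqxx andbT.
by move=> j jc; rewrite mxE [_ == j]eq_sym (negbTE jc) andbF.
Qed.

Lemma vproj_H (j : 'Z_n) : vproj j *m H = H *m vproj (j - 1).
Proof.
apply/matrixP => r c; rewrite vprojE mul_vproj mulrC.
have [->|/ht_deg ->] := eqVneq (H r c) 0; first by rewrite !mul0r.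
by rewrite [in RHS]eq_sym subr_eq [in RHS]eq_sym -natr1 addrA.
Qed.

Definition pow_H t : 'M[K]_d := iter t (mulmx H) 1%:M.

Lemma pow_HD s t : pow_H (s + t) = pow_H s *m pow_H t.
Proof.
rewrite /pow_H; elim: s => [|s IHs]; first by rewrite mul1mx.
by rewrite addSn !iterS IHs mulmxA.
Qed.

Lemma vproj_pow_H (j : 'Z_n) t : vproj j *m pow_H t = pow_H t *m vproj (j - t%:R).
Proof.
elim: t j => [|t IHt] j; first by rewrite /pow_H /= mulmx1 mul1mx subr0.
by rewrite {1}/pow_H iterS -/(pow_H t) mulmxA vproj_H -mulmxA IHt mulmxA -natr1
  opprD (addrC (- _)) addrA.
Qed.

Lemma pow_H_deg t r c : pow_H t r c != 0 -> ht r = (ht c + t)%N.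
Proof.
elim: t r => [|t IHt] r.
  by rewrite /pow_H mxE addn0; case: (eqVneq r c) => [-> //|_]; rewrite eqxx.
rewrite /pow_H iterS -/(pow_H t) mxE => nz.
have [u] : exists u, H r u * pow_H t u c != 0.
  apply/existsP; apply: contraR nz; rewrite negb_exists => /forallP h.
  by apply/eqP/big1 => u _; apply/eqP; move: (h u); rewrite negbK.
rewrite mulf_eq0 negb_or => /andP[/ht_deg -> /IHt ->].
by rewrite addnS.
Qed.

Lemma pow_H_eq0 t : (k <= t)%N -> pow_H t = 0.
Proof.
move=> kt; apply/matrixP => r c; rewrite [RHS]mxE; apply: contraTeq kt.
by move=> /pow_H_deg e; rewrite -ltnNge (leq_ltn_trans _ (ht_lt r)) // e leq_addl.
Qed.

Definition graded_mx (a : A) : 'M[K]_d :=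
  \sum_p (a p : K) *: (pow_H p.2 *m vproj p.1).

Fact graded_mx_is_linear : linear graded_mx.
Proof.
move=> c a b; rewrite /graded_mx scaler_sumr -big_split; apply: eq_bigr => p _.
by rewrite !ffunE scalerDl scalerA.
Qed.

HB.instance Definition _ := GRing.isLinear.Build K A 'M[K]_d _ graded_mx
  graded_mx_is_linear.

Lemma graded_mx_npath (j : 'Z_n) t :
  graded_mx (npath K k j t) = pow_H t *m vproj j.
Proof.
case: (ltnP t k) => [tk|kt]; last first.
  rewrite pow_H_eq0 // mul0mx /graded_mx big1 // => p _.
  rewrite ffunE andbC ltn_eqF ?scale0r // (leq_trans _ kt) //.
  by rewrite -[X in (_ < X)%N](prednK k_gt0).
have tk' : (t < k.-1.+1)%N by rewrite prednK.
rewrite /graded_mx (bigD1 (j, Ordinal tk')) //= big1 => [|[i' s] /= p].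
  by rewrite ffunE !eqxx scale1r addr0.
by move: p; rewrite ffunE xpair_eqE -val_eqE /= => /negbTE ->; rewrite scale0r.
Qed.

Lemma graded_mx1 : graded_mx 1 = 1%:M.
Proof.
rewrite nakayama_1E linear_sum -vproj_sum; apply: eq_bigr => j _.
by rewrite /= graded_mx_npath mul1mx.
Qed.

Lemma graded_mxM a b : graded_mx (a * b) = graded_mx a *m graded_mx b.
Proof.
have sumE (F : 'Z_n * 'I_k.-1.+1 -> A) :
    graded_mx (\sum_p F p) = \sum_p graded_mx (F p) by exact: linear_sum.
have scaleE c x : graded_mx (c *: x) = c *: graded_mx x by exact: linearZ.
rewrite [a]nakayamaE [b]nakayamaE mulr_suml !sumE mulmx_suml.
apply: eq_bigr => p _; rewrite mulr_sumr sumE mulmx_sumr; apply: eq_bigr => q _.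
rewrite -scalerAl -scalerAr !scaleE -scalemxAl -scalemxAr; congr (_ *: (_ *: _)).
rewrite npathM !graded_mx_npath -mulmxA (mulmxA (vproj _)) vproj_pow_H.
rewrite -(mulmxA (pow_H q.2)) vprojM subr_eq.
case: eqP => e; last by rewrite linear0 !mulmx0.
case: ltnP => l /=; first by rewrite graded_mx_npath addnC pow_HD mulmxA.
rewrite linear0 mulmxA -pow_HD pow_H_eq0 ?mul0mx // addnC.
by apply: leq_trans l; rewrite prednK.
Qed.

Definition graded_act (a : A) : 'End('cV[K]_d) := linfun (mulmx (graded_mx a)).

Lemma graded_actE a x : graded_act a x = graded_mx a *m x.
Proof. by rewrite lfunE. Qed.

Fact graded_act_is_linear : linear graded_act.
Proof.
move=> c a b; apply/lfunP => x.
by rewrite add_lfunE scale_lfunE !graded_actE linearP mulmxDl scalemxAl.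
Qed.

HB.instance Definition _ := GRing.isLinear.Build K A 'End('cV[K]_d) _ graded_act
  graded_act_is_linear.

Fact graded_act1 : graded_act 1 = \1%VF.
Proof. by apply/lfunP => x; rewrite graded_actE graded_mx1 mul1mx id_lfunE. Qed.

Fact graded_actM a b : graded_act (a * b) = (graded_act a \o graded_act b)%VF.
Proof.
by apply/lfunP => x; rewrite comp_lfunE !graded_actE graded_mxM mulmxA.
Qed.

Definition graded_mod : fdmod A := FdMod graded_act1 graded_actM.

Lemma graded_vertexE (j : 'Z_n) (x : graded_mod) :
  npath K k j 0 ** x = vproj j *m (x : 'cV_d).
Proof. by rewrite [LHS]graded_actE graded_mx_npath mul1mx. Qed.

Lemma graded_arrE (x : graded_mod) : arr ** x = H *m (x : 'cV_d).
Proof.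
rewrite [LHS]graded_actE; congr (_ *m _).
rewrite /arr linear_sum /= -[RHS]mulmx1 -vproj_sum mulmx_sumr.
by apply: eq_bigr => j _; rewrite graded_mx_npath {1}/pow_H /= mulmx1.
Qed.

End Graded.

(** * Uniserial modules *)

Section Uniserial.
Variables (i : 'Z_n) (l : nat).
Hypothesis l_le_k : (l <= k)%N.

Definition shift_mx : 'M[K]_l := \matrix_(r, c) (r == c.+1 :> nat)%:R.

Fact shift_lt (c : 'I_l) : (c < k)%N.
Proof. exact: leq_trans l_le_k. Qed.

Fact shift_deg (r c : 'I_l) : shift_mx r c != 0 -> r = c.+1 :> nat.
Proof. by rewrite mxE; case: (eqVneq (r : nat) c.+1) => // _; rewrite mulr0n eqxx. Qed.

Definition uniserial : fdmod A := graded_mod i shift_lt shift_deg.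

Definition bvec t : uniserial := (\col_(r < l) (r == t :> nat)%:R : 'cV[K]_l).

Lemma bvec_eq0 t : (bvec t == 0) = (l <= t)%N.
Proof.
apply/eqP/idP => [/matrixP b0|lt].
  rewrite leqNgt; apply/negP => tl; have /eqP := b0 (Ordinal tl) 0.
  by rewrite !mxE eqxx oner_eq0.
by apply/matrixP => r c; rewrite !mxE ltn_eqF // (leq_trans _ lt).
Qed.

Lemma sum_bvec (x : uniserial) : x = \sum_(t < l) x t 0 *: bvec t.
Proof.
apply/matrixP => r c; rewrite ord1 summxE (bigD1 r) //= big1 => [|t tr].
  by rewrite !mxE eqxx mulr1 addr0.
by rewrite !mxE val_eqE eq_sym (negbTE tr) mulr0.
Qed.

Lemma vertex_coord (j : 'Z_n) (x : uniserial) (r : 'I_l) :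
  (npath K k j 0 ** x : 'cV_l) r 0 = (i + r%:R == j)%:R * x r 0.
Proof. by rewrite graded_vertexE vprojE. Qed.

Lemma vertex_bvec (j : 'Z_n) t :
  npath K k j 0 ** bvec t = if i + t%:R == j then bvec t else 0.
Proof.
apply/matrixP => r c; rewrite ord1 vertex_coord mxE.
have [ij|ij] := eqVneq (i + t%:R) j; rewrite [RHS]mxE;
  case: (eqVneq (r : nat) t) => [->|_]; rewrite ?mulr0 //.
  by rewrite ij eqxx mul1r.
by rewrite (negbTE ij) mul0r.
Qed.

Lemma arr_bvec t : arr ** bvec t = bvec t.+1.
Proof.
apply/matrixP => r c; rewrite ord1 graded_arrE !mxE.
case: (ltnP t l) => [tl|lt].
  rewrite (bigD1 (Ordinal tl)) //= !mxE eqxx mulr1 big1 ?addr0 // => u.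
  by rewrite -val_eqE /= => /negbTE ut; rewrite !mxE ut mulr0.
rewrite big1 => [|u _]; last by rewrite !mxE (ltn_eqF (leq_trans _ lt)) ?mulr0.
by rewrite ltn_eqF // (leq_trans (ltn_ord r)) // leqW.
Qed.

Lemma arrX_bvec s t : arr ^+ s ** bvec t = bvec (t + s).
Proof.
elim: s => [|s IHs]; first by rewrite act_1 addn0.
by rewrite exprS act_M IHs arr_bvec addnS.
Qed.

Lemma arrX_coord0 (x : uniserial) t (r : 'I_l) : (r < t)%N ->
  (arr ^+ t ** x : 'cV_l) r 0 = 0.
Proof.
move=> rt; rewrite [x]sum_bvec linear_sum summxE big1 // => u _.
rewrite linearZ /= arrX_bvec mxE [X in _ * X]mxE ltn_eqF ?mulr0 //.
by rewrite (leq_trans rt) // leq_addl.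
Qed.

(** As l < n, the basis vectors sit at pairwise distinct vertices, so that
homogeneous vectors are multiples of them. *)
Lemma vertex_vec (j : 'Z_n) (x : uniserial) : npath K k j 0 ** x = x ->
  exists c t, x = c *: bvec t /\ (c != 0 -> (t < l)%N /\ j = i + t%:R).
Proof.
move=> ex; have [->|/eqP nx] := eqVneq x 0.
  by exists 0, 0%N; rewrite scale0r eqxx.
have hr r : x r 0 != 0 -> i + r%:R = j.
  rewrite -ex vertex_coord; have [//|_] := eqVneq (i + r%:R) j.
  by rewrite mul0r eqxx.
have [r nr] : exists r, x r 0 != 0.
  apply/existsP; apply: contra_notT nx; rewrite negb_exists => /forallP h.
  by apply/matrixP => r c; rewrite ord1 [RHS]mxE; apply/eqP/negPn.
exists (x r 0), (r : nat); split => [|_]; last by split => //; exact/esym/hr.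
rewrite [LHS]sum_bvec (bigD1 r) //= big1 ?addr0 // => u ur.
have [->|/hr eu] := eqVneq (x u 0) 0; first by rewrite scale0r.
case/eqP: ur; apply/val_inj/(@Zn_natrI i); last by rewrite eu hr.
  by rewrite (leq_trans (ltn_ord u)) // (leq_trans l_le_k) // ltnW.
by rewrite (leq_trans (ltn_ord r)) // (leq_trans l_le_k) // ltnW.
Qed.

Lemma uniserial_lfunP (V : vectType K) (f g : 'Hom(uniserial, V)) :
  (forall t, f (bvec t) = g (bvec t)) -> f = g.
Proof.
move=> e; apply/lfunP => x; rewrite [x]sum_bvec !linear_sum.
by apply: eq_bigr => t _; rewrite !linearZ /= e.
Qed.

(** A uniserial module is the quotient of a projective module by arr ^+ l: its
homomorphisms are the vectors at the vertex i that arr ^+ l annihilates. *)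
Section Universal.
Variables (N : fdmod A) (z : N).

Definition generate (v : uniserial) : N :=
  \sum_(t < l) (v : 'cV[K]_l) t 0 *: (arr ^+ t ** z).

Fact generate_is_linear : linear generate.
Proof.
move=> c u v; rewrite /generate scaler_sumr -big_split; apply: eq_bigr => t _.
by rewrite !mxE scalerDl scalerA.
Qed.

HB.instance Definition _ := GRing.isLinear.Build K uniserial N _ generate
  generate_is_linear.

Hypotheses (z_vertex : npath K k i 0 ** z = z) (z_arr : arr ^+ l ** z = 0).

Lemma generate_bvec t : generate (bvec t) = arr ^+ t ** z.
Proof.
case: (ltnP t l) => [tl|lt].
  rewrite /generate (bigD1 (Ordinal tl)) //= mxE eqxx scale1r big1 ?addr0 // => u.
  by rewrite -val_eqE /= => /negbTE ut; rewrite mxE ut scale0r.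
have /eqP -> : bvec t == 0 by rewrite bvec_eq0.
by rewrite linear0 -(subnK lt) act_XD z_arr linear0.
Qed.

Lemma generate_hom : is_hom (linfun generate).
Proof.
have gE t : linfun generate (bvec t) = arr ^+ t ** z by rewrite lfunE /= generate_bvec.
apply: hom_nakP => [j|] x; rewrite -!comp_lfunE; move: x; apply/lfunP.
  apply: uniserial_lfunP => t; rewrite !comp_lfunE vertex_bvec gE.
  rewrite (vertex_arrX _ _ z_vertex).
  by rewrite eq_sym; case: ifP => _; rewrite ?linear0 ?gE.
by apply: uniserial_lfunP => t; rewrite !comp_lfunE arr_bvec !gE exprS act_M.
Qed.

Lemma uniserial_universal :
  exists2 f : 'Hom(uniserial, N), is_hom f & f (bvec 0) = z.
Proof.
exists (linfun generate); first exact: generate_hom.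
by rewrite lfunE /= generate_bvec act_1.
Qed.
End Universal.

Lemma uniserial_hom_eq (N : fdmod A) (f g : 'Hom(uniserial, N)) :
  is_hom f -> is_hom g -> f (bvec 0) = g (bvec 0) -> f = g.
Proof.
move=> hf hg e; apply: uniserial_lfunP => t.
by rewrite -[t]add0n -arrX_bvec hf hg e.
Qed.

Lemma bvec0_vertex : npath K k i 0 ** bvec 0 = bvec 0.
Proof. by rewrite vertex_bvec addr0 eqxx. Qed.

End Uniserial.

(** * Bricks are uniserial *)

(** A module annihilated by arr ^+ l.+1 splits off the submodule generated by a
vector x that survives under arr ^+ l: this submodule is injective over the
quotient algebra that acts on M.  The retraction is written down explicitly;
over a brick it must be an isomorphism. *)
Section Brick.
Variables (M : fdmod A) (i : 'Z_n) (l : nat) (x : M).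
Hypothesis l_le_k : (l.+1 <= k)%N.
Hypotheses (x_vertex : npath K k i 0 ** x = x) (x_arr : arr ^+ l ** x != 0)
  (M_arr : forall y : M, arr ^+ l.+1 ** y = 0).
Variables (r0 : 'I_(fdmod_dim M)) (r0_neq0 : (arr ^+ l ** x : 'cV_(fdmod_dim M)) r0 0 != 0).
Local Notation S := (uniserial i l_le_k).

(** A linear form that is one at the socle vector arr ^+ l ** x and factors
through the projection onto its vertex. *)
Definition socle_form (y : M) : K :=
  ((npath K k (i + l%:R) 0 ** y : M) : 'cV_(fdmod_dim M)) r0 0 /
  (arr ^+ l ** x : 'cV_(fdmod_dim M)) r0 0.

(** The index l - t comes from arr ^+ (l - t) sending bvec t to the socle. *)
Definition retract (y : M) : S :=
  (\col_(t < l.+1) socle_form (arr ^+ (l - t) ** y) : 'cV_l.+1).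

Fact socle_form_linear c (u v : M) :
  socle_form (c *: u + v) = c * socle_form u + socle_form v.
Proof. by rewrite /socle_form !linearP !mxE mulrDl mulrA. Qed.

Fact retract_is_linear : linear retract.
Proof.
move=> c u v; apply/matrixP => r s.
by rewrite !mxE -socle_form_linear linearP.
Qed.

HB.instance Definition _ := GRing.isLinear.Build K M S _ retract
  retract_is_linear.

Lemma socle_form_vertex t (j : 'Z_n) (y : M) :
  socle_form (arr ^+ t ** (npath K k j 0 ** y)) =
  (i + l%:R == j + t%:R)%:R * socle_form (arr ^+ t ** y).
Proof.
have h : npath K k (i + l%:R) 0 ** (arr ^+ t ** (npath K k j 0 ** y)) =
    if i + l%:R == j + t%:R then npath K k (i + l%:R) 0 ** (arr ^+ t ** y) else 0.
  rewrite -!act_M !npath_arrX -mulrA npath00 subr_eq.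
  by case: eqP => [->|_]; rewrite ?addrK // mulr0 act_0.
rewrite /socle_form h; case: ifP => _; first by rewrite mul1r.
by rewrite mul0r mxE mul0r.
Qed.

Lemma retract_hom : is_hom (linfun retract).
Proof.
have rE y : linfun retract y = retract y by rewrite lfunE.
apply: hom_nakP => [j|] y; rewrite !rE; apply/matrixP => t c; rewrite ord1.
  rewrite vertex_coord !mxE socle_form_vertex; congr (_%:R * _).
  have tl : (t <= l)%N by rewrite -ltnS.
  by rewrite -[X in i + X%:R](subnKC tl) natrD addrA (inj_eq (addIr _)).
rewrite graded_arrE !mxE; case: (posnP t) => [t0|t_gt0].
  rewrite t0 subn0 -act_M -exprSr M_arr big1 => [|u _].
    by rewrite /socle_form linear0 mxE mul0r.
  by rewrite mxE t0 mul0r.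
have tl : (t.-1 < l.+1)%N by rewrite (leq_ltn_trans (leq_pred _)).
rewrite (bigD1 (Ordinal tl)) //= !mxE /= prednK // eqxx mul1r big1 => [|u].
  rewrite addr0 -act_M -exprSr; congr (socle_form (arr ^+ _ ** _)).
  by move: (ltn_ord t) t_gt0 => /=; lia.
rewrite -val_eqE /= !mxE => ut; rewrite [_ == _](_ : _ = false) ?mul0r //.
by lia.
Qed.

Lemma retract_gen : retract x = bvec i l_le_k 0.
Proof.
apply/matrixP => t c; rewrite !mxE -x_vertex socle_form_vertex.
have tl : (t <= l)%N by rewrite -ltnS.
have -> : (i + l%:R == i + (l - t)%:R) = (t == 0 :> nat).
  apply/eqP/eqP => [/Zn_natrI h|->]; last by rewrite subn0.
  by have := h ltac:(lia) ltac:(lia); lia.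
case: eqP => [->|_]; last by rewrite mul0r.
rewrite mul1r subn0 /socle_form -act_M npath_arrX addrK act_M x_vertex.
by rewrite divff.
Qed.

Lemma brick_iso_uniserial : \dim (homA M M) = 1%N -> iso S M.
Proof.
move=> d1; have [f hf fx] := uniserial_universal l_le_k x_vertex (M_arr x).
have hr := retract_hom.
have rf : (linfun retract \o f)%VF = \1%VF.
  apply: uniserial_hom_eq; [exact: hom_comp | exact: hom_id |].
  by rewrite comp_lfunE fx lfunE id_lfunE /= retract_gen.
have [c ec] := brick_hom d1 (hom_comp hr hf).
have c1 : c = 1.
  have /lfunP /(_ x) := ec; rewrite scale_lfunE id_lfunE comp_lfunE lfunE /=.
  rewrite retract_gen fx -{1}[x]scale1r => /eqP; rewrite -subr_eq0 -scalerBl.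
  rewrite scaler_eq0 subr_eq0 => /orP[/eqP -> //|/eqP x0].
  by move: x_arr; rewrite x0 linear0 eqxx.
exists f => //; split.
  apply/eqP/lker0P => u v e.
  by rewrite -[u]id_lfunE -[v]id_lfunE -rf !comp_lfunE e.
apply/vspaceP => y; rewrite memvf -[y]id_lfunE -[\1%VF]scale1r -c1 -ec.
by rewrite comp_lfunE memv_img // memvf.
Qed.

End Brick.

Lemma brick_uniserial (M : fdmod A) : \dim (homA M M) = 1%N ->
  exists i l, exists hl : (l.+1 <= k)%N, iso (uniserial i hl) M.
Proof.
move=> d1; have exl : exists l, fdmod_act M (arr ^+ l) == 0.
  by exists k; rewrite arrXk linear0.
have [[|l] /eqP hl lmin] := find_ex_minn exl.
  have : homA M M = 0%VS; last by move=> h; rewrite h dimv0 in d1.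
  apply/homA0P => g _; apply/lfunP => x; rewrite zero_lfunE.
  by rewrite -[x]act_1 -(expr0 arr) hl zero_lfunE linear0.
have lk : (l.+1 <= k)%N by apply: lmin; rewrite arrXk linear0.
have M_arr (y : M) : arr ^+ l.+1 ** y = 0 by rewrite hl zero_lfunE.
have nl : fdmod_act M (arr ^+ l) != 0.
  by apply/negP => /lmin; rewrite ltnn.
have [i [x nx]] : exists i (x : M), arr ^+ l ** (npath K k i 0 ** x) != 0.
  apply: contrapT => h; case/eqP: nl; apply/lfunP => x; rewrite zero_lfunE.
  rewrite -[x]act_1 nakayama_1E act_sum linear_sum big1 // => i _.
  by apply/eqP; apply: contra_notT h => nx; exists i, x.
have [r0 nr0] : exists r, (arr ^+ l ** (npath K k i 0 ** x) :
    'cV_(fdmod_dim M)) r 0 != 0.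
  apply: contrapT => h; case/eqP: nx; apply/matrixP => r c; rewrite ord1.
  by rewrite [RHS]mxE; apply/eqP; apply: contra_notT h => nr; exists r.
have ex : npath K k i 0 ** (npath K k i 0 ** x) = npath K k i 0 ** x.
  by rewrite -act_M npath00 eqxx.
by exists i, l, lk; exact: brick_iso_uniserial lk ex nx M_arr r0 nr0 d1.
Qed.

(** * Homomorphisms and extensions between uniserial modules *)

Lemma uniserial_dim_end (i : 'Z_n) l (hl : (l <= k)%N) : (0 < l)%N ->
  \dim (homA (uniserial i hl) (uniserial i hl)) = 1%N.
Proof.
move=> l_gt0; set S := uniserial i hl.
have nz : (\1%VF : 'Hom(S, S)) != 0.
  apply/eqP => /lfunP /(_ (bvec i hl 0)); rewrite id_lfunE zero_lfunE.
  by move/eqP; rewrite bvec_eq0 leqNgt l_gt0.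
rewrite (_ : homA S S = <[\1%VF]>%VS) ?dim_vline ?nz //.
apply/vspaceP => f; apply/idP/idP => [/memv_homA hf|/vlineP [c ->]]; last first.
  by apply/rpredZ/memv_homA; exact: hom_id.
have : npath K k i 0 ** f (bvec i hl 0) = f (bvec i hl 0).
  by rewrite -hf bvec0_vertex.
move=> /vertex_vec [c [t [e ct]]].
apply/vlineP; exists c; apply: uniserial_hom_eq => //.
  by move=> a x; rewrite !scale_lfunE !id_lfunE linearZ.
rewrite scale_lfunE id_lfunE e.
have [->|/ct [tl]] := eqVneq c 0; first by rewrite !scale0r.
move=> it; have h := @Zn_natrI i 0 t ltac:(lia) ltac:(lia).
by rewrite -h // addr0.
Qed.

Section Pairs.
Variables (i j : 'Z_n) (l m : nat) (l_le_k : (l <= k)%N) (m_le_k : (m <= k)%N).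
Local Notation X := (uniserial i l_le_k).
Local Notation Y := (uniserial j m_le_k).

(** A homomorphism is determined by the image of the generator of Y, a multiple of
some bvec t that arr ^+ m has to annihilate. *)
Lemma uniserial_homA0 : homA Y X = 0%VS <->
  ~ exists t, [/\ (t < l)%N, i + t%:R = j & (l <= t + m)%N].
Proof.
split=> [/homA0P h [t [tl itj ltm]]|h].
  have ev : npath K k j 0 ** bvec i l_le_k t = bvec i l_le_k t.
    by rewrite vertex_bvec itj eqxx.
  have [|f /h -> /esym/eqP] := uniserial_universal m_le_k ev.
    by apply/eqP; rewrite arrX_bvec bvec_eq0.
  by rewrite zero_lfunE bvec_eq0 leqNgt tl.
apply/homA0P => f hf; apply: uniserial_hom_eq => //.
  by move=> a x; rewrite !zero_lfunE linear0.
have : npath K k j 0 ** f (bvec j m_le_k 0) = f (bvec j m_le_k 0).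
  by rewrite -hf bvec0_vertex.
move=> /vertex_vec [c [t [e ct]]]; rewrite zero_lfunE e.
have [->|nc] := eqVneq c 0; first by rewrite scale0r.
have [tl itj] := ct nc; case: h; exists t; split => //.
have : arr ^+ m ** f (bvec j m_le_k 0) == 0.
  have /eqP e0 : bvec j m_le_k m == 0 by rewrite bvec_eq0.
  by rewrite -hf arrX_bvec add0n e0 linear0.
by rewrite e linearZ /= arrX_bvec scaler_eq0 (negbTE nc) bvec_eq0.
Qed.

(** Lift the generator of Y to the middle term: its image under arr ^+ m is a
multiple of some basis vector of X.  Unless the four conditions below
hold, it can be made to vanish by changing the lift. *)
Lemma uniserial_ext0 :
  ~ (exists s, [/\ (s < l)%N, (s < m)%N, j + m%:R = i + s%:R & (l + m <= s + k)%N]) ->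
  ext1_eq0 Y X.
Proof.
move=> h; apply: split_ext1_eq0 => Z.
have pi0 (v : X) : ext_proj Z (ext_inj Z v) = 0.
  by apply/eqP; rewrite -memv_ker -ext_exact memv_img // memvf.
have [y0 ey0] : exists y0, ext_proj Z y0 = bvec j m_le_k 0.
  have /memv_imgP [y0 _ ->] : bvec j m_le_k 0 \in limg (ext_proj Z).
    by rewrite ext_proj_epi memvf.
  by exists y0.
pose y := npath K k j 0 ** y0.
have ey : ext_proj Z y = bvec j m_le_k 0.
  by rewrite (@ext_proj_hom _ _ _ _ Z) ey0 bvec0_vertex.
have yv : npath K k j 0 ** y = y by rewrite -act_M npath00 eqxx.
have [w ew] : exists w, arr ^+ m ** y = ext_inj Z w.
  have /memv_imgP [w _ ->] : arr ^+ m ** y \in limg (ext_inj Z); last by exists w.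
  rewrite ext_exact memv_ker (@ext_proj_hom _ _ _ _ Z) ey arrX_bvec bvec_eq0.
  by rewrite leq_addl.
have inj_i : injective (ext_inj Z) by apply/lker0P; rewrite ext_inj_mono.
have /vertex_vec [c [s [ecs cs]]] : npath K k (j + m%:R) 0 ** w = w.
  by apply: inj_i; rewrite (@ext_inj_hom _ _ _ _ Z) -ew (vertex_arrX _ _ yv) eqxx.
have [v vv va] : exists2 v, npath K k j 0 ** v = v & arr ^+ m ** v = w.
  have [c0|nc] := eqVneq c 0.
    by exists 0; rewrite ?linear0 // ecs c0 scale0r.
  have [sl js] := cs nc.
  case: (ltnP s m) => [sm|ms].
    exfalso; apply: h; exists s; split => //; rewrite leqNgt; apply/negP => lt.
    have : arr ^+ (k - m) ** w == 0.
      apply/eqP/inj_i; rewrite (@ext_inj_hom _ _ _ _ Z) -ew -act_M -exprD.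
      by rewrite subnK // arrXk act_0 linear0.
    rewrite ecs linearZ /= arrX_bvec scaler_eq0 (negbTE nc) bvec_eq0 /=.
    by lia.
  exists (c *: bvec i l_le_k (s - m)).
    rewrite linearZ /= vertex_bvec natrB // addrA -js addrK eqxx //.
  by rewrite linearZ /= arrX_bvec subnK.
have [||f hf ef] := @uniserial_universal j m m_le_k _ (y - ext_inj Z v).
- by rewrite linearB /= yv -(@ext_inj_hom _ _ _ _ Z) vv.
- by rewrite linearB /= -(@ext_inj_hom _ _ _ _ Z) va ew subrr.
exists f => //; apply: uniserial_hom_eq.
- by apply: hom_comp => //; exact: ext_proj_hom.
- exact: hom_id.
- by rewrite comp_lfunE ef linearB /= pi0 subr0 ey id_lfunE.
Qed.

End Pairs.

(** * Nonsplit extensions *)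

(** Under the four conditions of [uniserial_ext0], the space Y + X carries, besides
the direct sum, the module structure in which arr ^+ m sends the generator of
Y to bvec s in X.  Both are built at once, with a coefficient c in front of
the gluing map. *)
Section NonSplit.
Variables (i j : 'Z_n) (l m s : nat) (l_le_k : (l <= k)%N) (m_le_k : (m <= k)%N).
Local Notation X := (uniserial i l_le_k).
Local Notation Y := (uniserial j m_le_k).
Hypotheses (s_lt_l : (s < l)%N) (s_lt_m : (s < m)%N) (ends : j + m%:R = i + s%:R)
  (lm_le : (l + m <= s + k)%N).

Definition glue_mx (c : K) : 'M[K]_(l, m) :=
  \matrix_(r, u) (c *+ ((r == s :> nat) && (u.+1 == m))).

Definition mid_shift (c : K) : 'M[K]_(m + l) :=
  block_mx (shift_mx m) 0 (glue_mx c) (shift_mx l).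

(** The basis vector of index s of X comes right after the last one of Y, hence
the shift by m - s. *)
Definition mid_height (a : 'I_(m + l)) : nat :=
  match fintype.split a with inl u => u | inr r => m - s + r end.

Lemma mid_height_l u : mid_height (lshift l u) = u.
Proof. by rewrite /mid_height (unsplitK (inl u)). Qed.

Lemma mid_height_r r : mid_height (rshift m r) = (m - s + r)%N.
Proof. by rewrite /mid_height (unsplitK (inr r)). Qed.

Fact mid_height_lt a : (mid_height a < k)%N.
Proof.
case: (split_ordP a) => u ->; rewrite ?mid_height_l ?mid_height_r.
  exact: leq_trans m_le_k.
by have := ltn_ord u; lia.
Qed.

Fact mid_height_deg c a b :
  mid_shift c a b != 0 -> mid_height a = (mid_height b).+1.
Proof.
rewrite /mid_shift; case: (split_ordP a) => u ->; case: (split_ordP b) => v ->.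
- by rewrite block_mxEul !mid_height_l => /shift_deg.
- by rewrite block_mxEur mxE eqxx.
- rewrite block_mxEdl mxE mid_height_r mid_height_l.
  by case: andP => [[/eqP -> /eqP vm] _|_]; [lia | rewrite mulr0n eqxx].
- by rewrite block_mxEdr !mid_height_r => /shift_deg ->; rewrite addnS.
Qed.

Definition mid c : fdmod A := graded_mod j mid_height_lt (@mid_height_deg c).

Definition mid_inj c (w : X) : mid c := col_mx (0 : 'cV[K]_m) (w : 'cV[K]_l).
Definition mid_proj c (w : mid c) : Y := usubmx (w : 'cV[K]_(m + l)).

Fact mid_inj_is_linear c : linear (@mid_inj c).
Proof.
move=> b u v; apply/esym.
transitivity (b *: col_mx (0 : 'cV[K]_m) (u : 'cV[K]_l) +
              col_mx (0 : 'cV[K]_m) (v : 'cV[K]_l)); first by [].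
by rewrite scale_col_mx add_col_mx scaler0 addr0.
Qed.

Fact mid_proj_is_linear c : linear (@mid_proj c).
Proof. by move=> b u v; apply/matrixP => r t; rewrite !mxE. Qed.

HB.instance Definition _ c := GRing.isLinear.Build K X (mid c) _ (@mid_inj c)
  (@mid_inj_is_linear c).
HB.instance Definition _ c := GRing.isLinear.Build K (mid c) Y _ (@mid_proj c)
  (@mid_proj_is_linear c).

Lemma mid_vertex c (v : 'Z_n) (x : mid c) (y : Y) (w : X) :
  x = col_mx (y : 'cV[K]_m) (w : 'cV[K]_l) ->
  npath K k v 0 ** x = col_mx (npath K k v 0 ** y : 'cV[K]_m)
                              (npath K k v 0 ** w : 'cV[K]_l) :> 'cV[K]_(m + l).
Proof.
move=> ->; apply/matrixP => r t; rewrite ord1 graded_vertexE vprojE.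
case: (split_ordP r) => a ->.
  by rewrite mid_height_l !col_mxEu vertex_coord.
rewrite mid_height_r !col_mxEd vertex_coord natrD natrB 1?ltnW // !addrA ends.
by rewrite addrK.
Qed.

Lemma mid_arr c (x : mid c) (y : Y) (w : X) :
  x = col_mx (y : 'cV[K]_m) (w : 'cV[K]_l) ->
  arr ** x = col_mx (arr ** y : 'cV[K]_m)
     (glue_mx c *m (y : 'cV[K]_m) + (arr ** w : 'cV[K]_l)) :> 'cV[K]_(m + l).
Proof.
move=> ->; rewrite graded_arrE /mid_shift mul_block_col mul0mx addr0.
by rewrite !graded_arrE.
Qed.

Lemma mid_injE c w : linfun (@mid_inj c) w = mid_inj c w.
Proof. by rewrite lfunE. Qed.

Lemma mid_projE c w : linfun (@mid_proj c) w = mid_proj w.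
Proof. by rewrite lfunE. Qed.

Fact mid_inj_hom c : is_hom (linfun (@mid_inj c)).
Proof.
apply: hom_nakP => [v|] w; rewrite !mid_injE.
  rewrite [RHS](@mid_vertex c v _ 0 w erefl) linear0.
  by [].
by rewrite [RHS](@mid_arr c _ 0 w erefl) linear0 mulmx0 add0r.
Qed.

Fact mid_proj_hom c : is_hom (linfun (@mid_proj c)).
Proof.
have e (x : mid c) : x = col_mx (mid_proj x : 'cV[K]_m) (dsubmx (x : 'cV[K]_(m + l))).
  by rewrite vsubmxK.
apply: hom_nakP => [v|] x; rewrite !mid_projE.
  by rewrite {1}/mid_proj (mid_vertex v (e x)) col_mxKu.
by rewrite {1}/mid_proj (mid_arr (e x)) col_mxKu.
Qed.

Fact mid_inj_mono c : lker (linfun (@mid_inj c)) = 0%VS.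
Proof.
apply/eqP/lker0P => u v; rewrite !mid_injE.
by move=> /eq_col_mx [].
Qed.

Fact mid_exact c : limg (linfun (@mid_inj c)) = lker (linfun (@mid_proj c)).
Proof.
apply/vspaceP => x; rewrite memv_ker mid_projE; apply/idP/eqP.
  by move=> /memv_imgP [w _ ->]; rewrite mid_injE /mid_proj col_mxKu.
move=> x0; have -> : x = linfun (@mid_inj c) (dsubmx (x : 'cV[K]_(m + l))).
  by rewrite mid_injE -[LHS]vsubmxK; congr col_mx.
by rewrite memv_img // memvf.
Qed.

Fact mid_epi c : limg (linfun (@mid_proj c)) = fullv.
Proof.
apply/vspaceP => y; rewrite memvf.
have -> : y = linfun (@mid_proj c) (col_mx (y : 'cV[K]_m) (0 : 'cV[K]_l)).
  by rewrite mid_projE /mid_proj col_mxKu.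
by rewrite memv_img // memvf.
Qed.

Definition mid_ext c : extension Y X :=
  Extension (@mid_inj_hom c) (@mid_proj_hom c) (mid_inj_mono c) (mid_exact c) (mid_epi c).

Lemma mid_arrXm c (x : mid c) (w : X) :
  x = col_mx (bvec j m_le_k 0 : 'cV[K]_m) (w : 'cV[K]_l) ->
  arr ^+ m ** x = col_mx (0 : 'cV[K]_m)
     (c *: bvec i l_le_k s + arr ^+ m ** w : 'cV[K]_l) :> 'cV[K]_(m + l).
Proof.
move=> ex; have h t : (t < m)%N -> arr ^+ t ** x =
   col_mx (bvec j m_le_k t : 'cV[K]_m) (arr ^+ t ** w : 'cV[K]_l) :> 'cV[K]_(m + l).
  elim: t => [|t IHt] tm; first by rewrite !act_1.
  rewrite !exprS !act_M (mid_arr (IHt (ltnW tm))) arr_bvec; congr col_mx.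
  rewrite (_ : glue_mx c *m _ = 0) ?add0r //; apply/matrixP => r a.
  rewrite !mxE big1 // => u _; rewrite !mxE; have [->|_] := eqVneq (u : nat) t.
    by rewrite (ltn_eqF tm) andbF mulr0n mul0r.
  by rewrite mulr0.
have m_gt0 : (0 < m)%N by exact: leq_ltn_trans s_lt_m.
have pm : (m.-1 < m)%N by rewrite prednK.
rewrite -[in LHS](prednK m_gt0) exprS act_M (mid_arr (h _ pm)) arr_bvec prednK //.
congr col_mx; first by apply/eqP; rewrite bvec_eq0.
rewrite -act_M -exprS prednK //; congr (_ + _).
apply/matrixP => r a; rewrite ord1 !mxE (bigD1 (Ordinal pm)) //= !mxE eqxx mulr1.
rewrite prednK // eqxx andbT mulr_natr big1 ?addr0 // => u.
by rewrite -val_eqE /= !mxE => /negbTE ->; rewrite mulr0.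
Qed.

(** The extension obtained by gluing is not equivalent to the direct sum: no
lift of the generator of Y is annihilated by arr ^+ m, the coordinate of
index s <= m - 1 being out of reach of arr ^+ m on X. *)
Lemma uniserial_ext_neq0 : ~ ext1_eq0 Y X.
Proof.
move=> /(_ (mid_ext 0) (mid_ext 1)) [h hh [_ /= hp]].
pose x : mid 0 := col_mx (bvec j m_le_k 0 : 'cV[K]_m) (0 : 'cV[K]_l).
have x0 : arr ^+ m ** x = 0.
  rewrite [LHS](@mid_arrXm 0 x 0 erefl) scale0r linear0 addr0.
  by apply/matrixP => r a; rewrite !mxE; case: fintype.split => u; rewrite !mxE.
have hx : h x = col_mx (bvec j m_le_k 0 : 'cV[K]_m)
    (dsubmx (h x : 'cV[K]_(m + l))) :> 'cV[K]_(m + l).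
  rewrite -[LHS]vsubmxK; congr col_mx; have /lfunP /(_ x) := hp.
  by rewrite comp_lfunE !mid_projE /mid_proj col_mxKu.
have := mid_arrXm hx; rewrite -hh x0 linear0 -[X in X = _]col_mx0.
move=> /eq_col_mx [_ /matrixP /(_ (Ordinal s_lt_l) 0)].
rewrite scale1r !mxE eqxx [X in 1 + X](_ : _ = 0) ?addr0 => [/esym/eqP|].
  by rewrite oner_eq0.
by rewrite arrX_coord0.
Qed.

End NonSplit.
End NakayamaModules.

(** * Weak exceptional sequences as sequences of arcs *)

Section ArcModules.
Variables (K : fieldType) (n : nat).
Hypothesis n_gt2 : (2 < n)%N.
Local Notation A := (nakayama K n n.-1).

Let n_gt1 : (1 < n)%N. Proof. exact: ltnW. Qed.
Let k_gt0 : (0 < n.-1)%N. Proof. by rewrite -subn1 subn_gt0. Qed.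
Let k_lt_n : (n.-1 < n)%N. Proof. by rewrite prednK // ltnW. Qed.

(** The minimum, equal to the length for an arc, gives a module for all pairs. *)
Definition arc_mod (e : nat * nat) : fdmod A :=
  uniserial K k_gt0 (e.1%:R : 'Z_n) (geq_minr (steps n e.1 e.2) n.-1).

Lemma steps_lt x y : (x < n)%N -> (y < n)%N -> (steps n x y < n)%N.
Proof. by have := stepsP n x y; lia. Qed.

Lemma steps_gt0 e : is_arc n e -> (0 < steps n e.1 e.2)%N.
Proof. by rewrite /is_arc; have := stepsP n e.1 e.2; lia. Qed.

Lemma steps_min e : is_arc n e -> minn (steps n e.1 e.2) n.-1 = steps n e.1 e.2.
Proof.
by move=> /and3P[h1 h2 _]; apply/minn_idPl; have := steps_lt h1 h2; lia.
Qed.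

Lemma add_steps x y : (x < n)%N -> (y < n)%N ->
  x%:R + (steps n x y)%:R = y%:R :> 'Z_n.
Proof.
move=> xn yn; rewrite -natrD; have [[xy ->]|[yx ->]] := stepsP n x y.
  by rewrite subnKC.
by rewrite subnKC ?natrD ?pchar_Zp ?addr0 //; lia.
Qed.

Lemma steps_natr x y t : (x < n)%N -> (y < n)%N -> (t < n)%N ->
  x%:R + t%:R = y%:R :> 'Z_n -> t = steps n x y.
Proof.
move=> xn yn tn; rewrite -(add_steps xn yn) => /(Zn_natrI n_gt1); apply => //.
exact: steps_lt.
Qed.

Lemma arc_mod_homA0 a b : is_arc n a -> is_arc n b ->
  homA (arc_mod b) (arc_mod a) = 0%VS <-> ~~ arc_hom n b a.
Proof.
move=> Aa Ab; have /and3P[a1 a2 _] := Aa; have /and3P[b1 b2 _] := Ab.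
rewrite /arc_mod uniserial_homA0 // !steps_min //.
split=> [h|/negP h [t [tl e lt]]].
  apply/negP => /andP[h1 h2]; apply: h; exists (steps n a.1 b.1); split => //.
  exact: add_steps.
apply: h; rewrite /arc_hom -(steps_natr _ _ _ e) ?tl //.
by rewrite (ltn_trans tl) // steps_lt.
Qed.

Lemma arc_mod_ext0 a b : is_arc n a -> is_arc n b ->
  ext1_eq0 (arc_mod b) (arc_mod a) <-> ~~ arc_ext n b a.
Proof.
move=> Aa Ab; have /and3P[a1 a2 _] := Aa; have /and3P[b1 b2 _] := Ab.
split=> [h|/negP h].
  apply/negP => /and3P[h1 h2 h3]; move: h.
  apply: (@uniserial_ext_neq0 _ _ _ n_gt1 _ k_lt_n _ _ _ _ (steps n a.1 b.2));
    rewrite ?steps_min //.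
  by rewrite !add_steps.
apply: uniserial_ext0 => //; rewrite !steps_min // => -[s [s1 s2 e s3]].
rewrite add_steps // in e; apply: h; rewrite /arc_ext -(steps_natr _ _ _ (esym e)) ?s1 ?s2 //.
by rewrite (ltn_trans s1) // steps_lt.
Qed.

Lemma arc_mod_dim_end a : is_arc n a -> \dim (homA (arc_mod a) (arc_mod a)) = 1%N.
Proof. by move=> Aa; apply: uniserial_dim_end => //; rewrite steps_min // steps_gt0. Qed.

Lemma arc_mod_weak_exceptional a : is_arc n a -> weak_exceptional (arc_mod a).
Proof.
move=> Aa; split; first exact: arc_mod_dim_end.
apply/arc_mod_ext0 => //; move: Aa; case: a => p q; rewrite /is_arc /arc_ext /=.
by have := stepsP n p q; lia.
Qed.

Lemma arc_mod_pair a b : is_arc n a -> is_arc n b ->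
  weak_exceptional_pair (arc_mod a) (arc_mod b) <-> before n a b.
Proof.
move=> Aa Ab; split=> [[_ _ h1 h2]|/andP[h1 h2]].
  by apply/andP; split; [apply/arc_mod_homA0 | apply/arc_mod_ext0].
split; try exact: arc_mod_weak_exceptional.
  exact/arc_mod_homA0.
exact/arc_mod_ext0.
Qed.

Lemma brick_arc (M : fdmod A) : \dim (homA M M) = 1%N ->
  exists2 e, is_arc n e & iso (arc_mod e) M.
Proof.
move=> d1; have [i [l [hl isoM]]] := brick_uniserial n_gt1 k_gt0 k_lt_n d1.
have [p p_n ei] : exists2 p : nat, (p < n)%N & p%:R = i.
  by exists i; rewrite ?natr_Zp // -[X in (_ < X)%N](Zp_cast n_gt1).
pose q := if (p + l.+1 < n)%N then (p + l.+1)%N else (p + l.+1 - n)%N.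
have [q_n pq offE] : [/\ (q < n)%N, p != q & steps n p q = l.+1].
  by rewrite /q; case: (ltnP (p + l.+1)%N n) => h; split; try lia;
    [have := stepsP n p (p + l.+1) | have := stepsP n p (p + l.+1 - n)]; lia.
have Apq : is_arc n (p, q) by rewrite /is_arc /= p_n q_n pq.
exists (p, q) => //; suff -> : arc_mod (p, q) = uniserial K k_gt0 i hl by [].
rewrite /arc_mod /=; move: (geq_minr (steps n p q) n.-1).
rewrite (steps_min Apq) /= offE ei => hl'.
by rewrite (bool_irrelevance hl hl').
Qed.

Definition arc_class e : set (fdmod A) := iso_class (arc_mod e).

Lemma eq_map_all (T U : Type) (P : pred T) (f g : T -> U) (s : seq T) :
  (forall x, P x -> f x = g x) -> all P s -> map f s = map g s.
Proof. by move=> h; elim: s => //= x s IHs /andP[/h -> /IHs ->]. Qed.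

Lemma wes_arcs c : wes A c -> exists a, [/\ forall e, e \in a -> is_arc n e,
  pairwise (before n) a & c = map arc_class a].
Proof.
move=> [s [s_we s_pair] <-].
have h (M : fdmod A) : exists e, weak_exceptional M -> is_arc n e /\ iso (arc_mod e) M.
  have [we|nwe] := pselect (weak_exceptional M); last by exists (0%N, 0%N).
  by have [e h1 h2] := brick_arc we.1; exists e.
have [f fP] := choice h; exists (map f s); split.
- apply/allP; rewrite all_map; apply: sub_all s_we => M /asboolP we /=.
  by case: (fP _ we).
- rewrite pairwise_map; apply: (sub_in_pairwise _ s_we) s_pair => M N.
  rewrite !unfold_in => /asboolP wM /asboolP wN /asboolP [_ _ h1 h2].
  have [aM iM] := fP _ wM; have [aN iN] := fP _ wN; apply/andP; split.
    by apply/arc_mod_homA0 => //; apply: iso_homA0 h1; exact: iso_sym.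
  by apply/arc_mod_ext0 => //; apply: iso_ext1_eq0 h2; exact: iso_sym.
- rewrite -map_comp; apply: eq_map_all s_we => M /asboolP we /=.
  by apply/esym/eq_iso_class; case: (fP _ we).
Qed.

Lemma arcs_wes a : (forall e, e \in a -> is_arc n e) -> pairwise (before n) a ->
  wes A (map arc_class a) /\ uniq (map arc_class a).
Proof.
move=> aA ab; have pa : pairwise (fun e f =>
    `[< weak_exceptional_pair (arc_mod e) (arc_mod f) >]) a.
  apply: (sub_in_pairwise (P := mem a)) (allss _) ab => e f /aA he /aA hf /= ef.
  by apply/asboolP/arc_mod_pair.
split.
  exists (map arc_mod a); last by rewrite -map_comp.
  split; last by rewrite pairwise_map.
  rewrite all_map; apply/allP => e /aA he; apply/asboolP.
  exact: arc_mod_weak_exceptional.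
rewrite uniq_pairwise pairwise_map.
apply: (sub_in_pairwise (P := mem a)) (allss _) pa => e f /aA he /aA hf.
move=> /asboolP [_ _ h _] /=; apply/eqP => /eq_iso_class ief.
have := arc_mod_dim_end he; suff -> : homA (arc_mod e) (arc_mod e) = 0%VS.
  by rewrite dimv0.
by apply: iso_homA0 h; [exact: iso_sym | exact: iso_refl].
Qed.

Lemma wes_size_le c : wes A c -> (wes_size c <= 2 * n.-1)%N.
Proof.
move=> /wes_arcs [a [aA ab ->]]; apply: leq_trans (size_undup _) _.
by rewrite size_map; apply: size_collection aA ab _; lia.
Qed.

Definition star_class v := map arc_class (star n v).

Lemma star_class_wes v : (v < n)%N ->
  wes A (star_class v) /\ wes_size (star_class v) = (2 * n.-1)%N.
Proof.
move=> vn; have [h1 h2] := arcs_wes (@star_arc n v vn) (star_before vn).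
by split => //; rewrite /wes_size undup_id // size_map size_star.
Qed.

Lemma wes_supE : wes_sup A = (2 * n.-1)%N%:R%:E.
Proof.
apply/eqP; rewrite eq_le; apply/andP; split.
  apply: ge_ereal_sup => _ [c cw <-].
  by rewrite lee_fin ler_nat wes_size_le.
have [w0 s0] := @star_class_wes 0 (ltnW (ltnW n_gt2)).
have in0 : [set (wes_size c)%:R%:E | c in wes A] ((2 * n.-1)%N%:R%:E : \bar rat).
  by exists (star_class 0) => //; rewrite s0.
apply: ge_supremum_Nmem => //.
exists ((2 * n.-1)%N%:R%:E); split => [_ [c cw <-]|y]; last exact.
by rewrite lee_fin ler_nat wes_size_le.
Qed.

Lemma full_wesE : full_wes A = [set star_class v | v in `I_n].
Proof.
apply/seteqP; split=> [c [cw]|_ [v vn <-]]; last first.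
  by have [h1 h2] := star_class_wes vn; split => //; rewrite h2 wes_supE.
rewrite wes_supE => -[] /eqP; rewrite eqr_nat => /eqP sc.
have [a [aA ab ec]] := wes_arcs cw.
have sa : size a = (2 * n.-1)%N.
  apply/eqP; rewrite eqn_leq size_collection //; last by lia.
  by rewrite -sc ec -(size_map arc_class) size_undup.
have [v vn ea] := full_star n_gt2 aA ab sa.
by exists v => //; rewrite ec ea.
Qed.

(** The arcs that end at v come first, the shortest one in front: it starts one
step before v. *)
Lemma head_star v : (v < n)%N -> exists x t,
  star n v = (x, v) :: t /\ is_arc n (x, v) /\ steps n x v = 1%N.
Proof.
move=> vn; pose y := if v == 0%N then n.-1 else v.-1.
have yn : (y < n)%N by rewrite /y; case: (v =P 0%N); lia.
have offvy : steps n v y = n.-1.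
  by rewrite /y; case: (v =P 0%N) => [->|];
     [have := stepsP n 0 n.-1 | have := stepsP n v v.-1]; lia.
have yo : y \in others n v.
  by rewrite mem_others yn /= /y; case: (v =P 0%N); lia.
have dec := others_decreasing vn; rewrite /star.
case: (others n v) yo dec (@mem_others n v) => [//|x t] yo /= /andP[xt _] mo.
exists x; eexists; split; first by [].
have /andP[xn xv] : (x < n)%N && (x != v) by rewrite -mo mem_head.
suff e : y = x.
  rewrite /is_arc /= xn vn xv; split => //; rewrite -e.
  by rewrite /y; case: (v =P 0%N) => [->|];
     [have := stepsP n n.-1 0 | have := stepsP n v.-1 v]; lia.
move: yo; rewrite inE => /orP[/eqP //|/(allP xt)].
by rewrite offvy; have := steps_lt vn xn; lia.
Qed.

(** The simple first term of a star determines its centre, because a nonzero map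
between simple modules forces equal tops. *)
Lemma star_class_inj : {in `I_n &, injective star_class}.
Proof.
move=> v w; rewrite !inE => vn wn; rewrite /star_class.
have [x [t [-> [xv ox]]]] := head_star vn; have [y [u [-> [yw oy]]]] := head_star wn.
move=> [/eq_iso_class ixy _].
have hn : arc_hom n (x, v) (y, w).
  apply: contraT => /(arc_mod_homA0 yw xv) h.
  have := arc_mod_dim_end yw; rewrite (iso_homA0 ixy (iso_refl _) h).
  by rewrite dimv0.
move: hn ox oy xv yw; rewrite /arc_hom /is_arc /=.
have := stepsP n x v; have := stepsP n y w; have := stepsP n y x.
by lia.
Qed.

Lemma card_full_wes : full_wes A #= `I_n.
Proof. by rewrite full_wesE; apply: inj_card_eq; exact: star_class_inj. Qed.

End ArcModules.

Theorem theorem1p5 (K : fieldType) (n : nat) (hn : (3 <= n)%N) :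
  wes_sup (nakayama K n n.-1) = (2 * n - 2)%N%:R%:E /\
  (full_wes (nakayama K n n.-1) #= `I_n)%card.
Proof.
split; last exact: card_full_wes.
by rewrite wes_supE // -subn1 mulnBr.
Qed.
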